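(* Let $f(z)=z+\sum_{n\ge 2}a_nz^n\in\mathcal{BT}_{\mathfrak{B}}$ and let $\Gamma_1,\Gamma_2,\Gamma_3$ be the logarithmic inverse coefficients of $f$. Then $$|H_{2,1}(F_{f^{-1}}/2)|=|\Gamma_1\Gamma_3-\Gamma_2^2|\le\frac{1}{144}.$$ The inequality is sharp, with equality for $f_2(z)=\int_0^z\sqrt{1+\tanh(t^2)}\,dt$.
   Context: $\mathbb{D}=\{z\in\mathbb{C}:|z|<1\}$. $\mathcal{S}$ is the class of univalent analytic functions $f$ on $\mathbb{D}$ normalized by $f(0)=0$, $f'(0)=1$, i.e. $f(z)=z+\sum_{n\ge2}a_nz^n$. For analytic $g,h$ on $\mathbb{D}$, $g\prec h$ means there is an analytic $\omega:\mathbb{D}\to\mathbb{D}$ with $\omega(0)=0$ and $g=h\circ\omega$. Let $\mathfrak{B}(z)=\sqrt{1+\tanh z}$ (principal branch, $\mathfrak{B}(0)=1$). The class $\mathcal{BT}_{\mathfrak{B}}$ is $\{f\in\mathcal{S}: f'(z)\prec \mathfrak{B}(z)\}$. For $f\in\mathcal{S}$ the logarithmic inverse coefficients $\Gamma_n$ are defined by $F_{f^{-1}}(w):=\log\frac{f^{-1}(w)}{w}=2\sum_{n\ge1}\Gamma_n w^n$ near $w=0$; explicitly $\Gamma_1=-\tfrac12a_2$, $\Gamma_2=-\tfrac12(a_3-\tfrac32a_2^2)$, $\Gamma_3=-\tfrac12(a_4-4a_2a_3+\tfrac{10}{3}a_2^3)$. The Hankel determinant $H_{2,1}(F_{f^{-1}}/2):=\Gamma_1\Gamma_3-\Gamma_2^2=\frac{1}{48}(13a_2^4-12a_2^2a_3-12a_3^2+12a_2a_4)$.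 *)

(* Defs.v *)
From HB Require Import structures.
From mathcomp Require Import all_boot all_order all_algebra.
From mathcomp Require Import all_classical all_reals all_analysis.
From mathcomp Require Import complex.
Set Implicit Arguments. Unset Strict Implicit. Unset Printing Implicit Defensive.
Import Order.TTheory GRing.Theory Num.Theory.
Import numFieldNormedType.Exports.
Local Open Scope ring_scope.

Section Defs.
Variable R : realType.
Local Notation C := R[i].

Definition inD (z : C) : Prop := `|z| < 1.

Definition holo_on_D (f : C -> C) : Prop :=
  forall z, inD z -> derivable (f : C^o -> C^o) z 1.

Definition dC (f : C -> C) : C -> C := derive1 (f : C^o -> C^o).

Definition coef (f : C -> C) (n : nat) : C := derive1n n (f : C^o -> C^o) 0 / n`!%:R.

Definition classS (f : C -> C) : Prop :=
  [/\ holo_on_D f, (forall z1 z2, inD z1 -> inD z2 -> f z1 = f z2 -> z1 = z2), f 0 = 0 & dC f 0 = 1].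

Definition subord (g h : C -> C) : Prop :=
  exists w : C -> C, [/\ holo_on_D w, (forall z, inD z -> inD (w z)), w 0 = 0 &
     forall z, inD z -> g z = h (w z)].

(* complex exponential via its power series, tanh, and B(z) = sqrt(1 + tanh z)
   with the principal branch of the square root (sqrtc). *)
Definition expC (z : C) : C := limn (series (fun n => z ^+ n / n`!%:R : C^o)).
Definition tanhC (z : C) : C := (expC z - expC (- z)) / (expC z + expC (- z)).
Definition frakB (z : C) : C := sqrtc (1 + tanhC z).

Definition classBT (f : C -> C) : Prop := classS f /\ subord (dC f) frakB.

Definition Gamma1 (f : C -> C) : C := - (coef f 2) / 2.
Definition Gamma2 (f : C -> C) : C :=
  - (coef f 3 - 3 / 2 * (coef f 2) ^+ 2) / 2.
Definition Gamma3 (f : C -> C) : C :=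
  - (coef f 4 - 4 * coef f 2 * coef f 3 + 10 / 3 * (coef f 2) ^+ 3) / 2.

Definition H21inv (f : C -> C) : C := Gamma1 f * Gamma3 f - (Gamma2 f) ^+ 2.

End Defs.

(* Main.v *)
Require Import Defs.
From HB Require Import structures.
From mathcomp Require Import all_boot all_order all_algebra.
From mathcomp Require Import all_classical all_reals all_analysis.
From mathcomp Require Import complex ring lra.
Set Implicit Arguments.
Unset Strict Implicit.
Unset Printing Implicit Defensive.
Import Order.TTheory GRing.Theory Num.Theory.
Import numFieldNormedType.Exports.
Local Open Scope ring_scope.

(** Write f' = B(w) with w a Schwarz function with Taylor coefficients c1, c2, c3.
    From 2 f'' = f' (2 - f'^2) w' (a consequence of tanh' = 1 - tanh^2) one gets
      a2 = c1/4,  a3 = c2/6 - c1^2/24,  a4 = c3/8 - c1 c2/16 - 5 c1^3/192,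
      48 H = -13/768 c1^4 - 7/48 c1^2 c2 - c2^2/3 + 3/8 c1 c3,
    and |48 H| <= 1/3 follows by the triangle inequality from Schur's inequality
      |(1 - |c1|^2) c3 + conj(c1) c2^2| <= (1 - |c1|^2)^2 - |c2|^2,
    which expresses that the lower triangular Toeplitz matrix of (c1, c2, c3) is a
    contraction.

    The analyticity of f and w comes from Cauchy's formula, proved without integration.
    Since Re B > 0 on the disc, f' is continuous, so Goursat's theorem is not needed.
    The normalized integral over the circle |e| = r is replaced by a limit, along an
    ultrafilter, of averages over the 2^n-th roots of unity: it is a positive linear
    functional on all bounded functions, and it kills e F'(e) because the increments of
    F along the roots of unity telescope to 0.

    For sharpness, f2 is the termwise primitive of the Taylor series of B(z^2); it is
    univalent since Re f2' > 0. *)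

(** Membership in [classBT] gives only pointwise complex differentiability of f and w, while [coef]
    is an iterated derivative and Schur's inequality concerns power series coefficients. [C1],
    differentiability with a continuous derivative, bridges the two: it is what Cauchy's formula
    asks for, and it has to be established for w as well as for f. The Toeplitz contraction is
    tested on explicit vectors instead of running the Schur algorithm, because this uses only the
    positivity of the mean and never divides w by z or composes it with Moebius maps. The value 1/3
    is the coefficient of c2^2, attained at c1 = 0, |c2| = 1. Once Schur's inequality has eliminated
    c3 and bounded |c2| by 1 - |c1|^2, the remaining bound is 1/3 - 7/48 |c1|^2 - 131/768 |c1|^4. *)

Local Notation nrm := (@ComplexField.Normc.normc _).

(** * Complex modulus and derivatives *)

Section ComplexModulus.
Variable R : realType.
Implicit Types (x y z : R[i]) (r : R).

Lemma normC_nrm z : `|z| = ((nrm z)%:C)%C.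
Proof. by []. Qed.

Lemma nrm_ge0 z : 0 <= nrm z.
Proof. by rewrite -lecR -normC_nrm normr_ge0. Qed.

Lemma nrm0 : nrm (0 : R[i]) = 0.
Proof. exact: ComplexField.Normc.normc0. Qed.

Lemma nrm1 : nrm (1 : R[i]) = 1.
Proof. exact: ComplexField.Normc.normc1. Qed.

Lemma nrm_eq0 z : (nrm z == 0) = (z == 0).
Proof.
apply/eqP/eqP => [|->]; first exact: ComplexField.Normc.eq0_normc.
exact: nrm0.
Qed.

Lemma nrm_gt0 z : (0 < nrm z) = (z != 0).
Proof. by rewrite lt_neqAle nrm_ge0 andbT eq_sym nrm_eq0. Qed.

Lemma nrmM x y : nrm (x * y) = nrm x * nrm y.
Proof. exact: ComplexField.Normc.normcM. Qed.

Lemma nrmV x : nrm x^-1 = (nrm x)^-1.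
Proof. exact: ComplexField.Normc.normcV. Qed.

Lemma nrmX x n : nrm (x ^+ n) = nrm x ^+ n.
Proof. by elim: n => [|n IH]; rewrite ?expr0 ?nrm1// !exprS nrmM IH. Qed.

Lemma nrmD x y : nrm (x + y) <= nrm x + nrm y.
Proof. exact: le_normcD. Qed.

Lemma nrmN x : nrm (- x) = nrm x.
Proof. exact: normcN. Qed.

Lemma nrmB x y : nrm (x - y) <= nrm x + nrm y.
Proof. by rewrite -(nrmN y) nrmD. Qed.

Lemma nrmBC x y : nrm (x - y) = nrm (y - x).
Proof. by rewrite -nrmN opprB. Qed.

Lemma nrm_ler_sub x y : nrm x - nrm y <= nrm (x - y).
Proof. by rewrite lerBlDr -{1}(subrK y x) nrmD. Qed.

Lemma nrm_split x y : nrm x <= nrm (x - y) + nrm y.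
Proof. by rewrite -{1}(subrK y x) nrmD. Qed.

Lemma nrm_dist3 x y z : nrm (x - z) <= nrm (x - y) + nrm (y - z).
Proof. by have := nrmD (x - y) (y - z); rewrite addrA subrK. Qed.

Lemma nrm_sum (I : Type) (s : seq I) (P : pred I) (F : I -> R[i]) :
  nrm (\sum_(i <- s | P i) F i) <= \sum_(i <- s | P i) nrm (F i).
Proof.
elim/big_ind2 : _ => //; first by rewrite nrm0.
by move=> x1 x2 y1 y2 h1 h2; apply: le_trans (nrmD _ _) _; exact: lerD.
Qed.

Lemma nrmR r : nrm (r%:C)%C = `|r|.
Proof. by rewrite /= expr0n /= addr0 sqrtr_sqr. Qed.

Lemma nrm_nat n : nrm (n%:R : R[i]) = n%:R.
Proof. by rewrite -(rmorph_nat (real_complex R)) nrmR normr_nat. Qed.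

Lemma Re_le_nrm z : `|complex.Re z| <= nrm z.
Proof.
by case: z => a b /=; rewrite -sqrtr_sqr ler_wsqrtr // lerDl sqr_ge0.
Qed.

Lemma Im_le_nrm z : `|complex.Im z| <= nrm z.
Proof.
by case: z => a b /=; rewrite -sqrtr_sqr ler_wsqrtr // lerDr sqr_ge0.
Qed.

Lemma nrm_le_ReIm z : nrm z <= `|complex.Re z| + `|complex.Im z|.
Proof.
rewrite [in leLHS](complexE z); apply: le_trans (nrmD _ _) _.
rewrite nrmM !nrmR lerD2l.
have -> : nrm ('i%C : R[i]) = 1 by rewrite /= expr0n /= add0r expr1n sqrtr1.
by rewrite mul1r.
Qed.

Lemma nrm_conj z : nrm (z^*)%C = nrm z.
Proof. by case: z => a b /=; rewrite sqrrN. Qed.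

Lemma mul_conj z : z * (z^*)%C = ((nrm z ^+ 2)%:C)%C.
Proof. by rewrite rmorphXn /= -normC_nrm sqr_normc. Qed.

Lemma Re_mul_conj z : complex.Re (z * (z^*)%C) = nrm z ^+ 2.
Proof. by rewrite mul_conj. Qed.

Lemma sqr_nrm z : nrm z ^+ 2 = complex.Re z ^+ 2 + complex.Im z ^+ 2.
Proof. by case: z => a b /=; rewrite sqr_sqrtr // addr_ge0 // sqr_ge0. Qed.

Lemma ReD x y : complex.Re (x + y) = complex.Re x + complex.Re y.
Proof. by case: x; case: y. Qed.

Lemma ReB x y : complex.Re (x - y) = complex.Re x - complex.Re y.
Proof. by case: x; case: y. Qed.

Lemma ReZ r x : complex.Re ((r%:C)%C * x) = r * complex.Re x.
Proof. by case: x => a b /=; rewrite mul0r subr0. Qed.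

Lemma conjcD x y : ((x + y)^*)%C = (x^*)%C + (y^*)%C.
Proof. exact: rmorphD. Qed.

Lemma conjcM x y : ((x * y)^*)%C = (x^*)%C * (y^*)%C.
Proof. exact: rmorphM. Qed.

Lemma conjcX x n : ((x ^+ n)^*)%C = (x^*)%C ^+ n.
Proof. exact: rmorphXn. Qed.

Lemma conjcV x : (x^-1^*)%C = (x^*)%C^-1.
Proof. exact: fmorphV. Qed.

Lemma inDE z : inD z <-> nrm z < 1.
Proof. by rewrite /inD normC_nrm -[1]/((1%:C)%C) ltcR. Qed.

End ComplexModulus.

Lemma numField_derivP (K : numFieldType) (f : K -> K) (z d : K) :
  (forall e : K, 0 < e -> exists2 r : K, 0 < r & forall h, `|h| < r ->
    `|f (z + h) - f z - d * h| <= e * `|h|) <->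
  ((h^-1 *: ((f : K^o -> K^o) (h + z) - f z)) @[h --> (0 : K)^'] --> (d : K^o))%classic.
Proof.
have key h : h != 0 ->
    d - h^-1 *: ((f : K^o -> K^o) (h + z) - f z) = - ((f (z + h) - f z - d * h) / h).
  by move=> h0; rewrite /GRing.scale /= (addrC h); field.
split=> H.
  apply/cvgrPdist_le => e e0; have [r r0 Hr] := H e e0.
  near=> h.
  have h0 : h != 0 by near: h; exact: nbhs_dnbhs_neq.
  rewrite key // normrN normrM normfV ler_pdivrMr ?normr_gt0 //.
  by apply: Hr; near: h; exact: dnbhs0_lt.
move=> e e0; move/cvgrPdist_le : H => /(_ e e0).
move=> /nbhs_ballP[r /= r0 Hb].
exists r => // h hr.
have [->|h0] := eqVneq h 0; first by rewrite addr0 subrr mulr0 subrr normr0 mulr0.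
have /Hb : ball (0 : K) r h by rewrite -ball_normE /= sub0r normrN.
by move=> /(_ h0); rewrite key // normrN normrM normfV ler_pdivrMr ?normr_gt0.
Unshelve. all: by end_near. Qed.

(** Stated over an arbitrary [numFieldType] because it serves twice: over R[i] for [deriv_at], and
    over R to feed the real mean value theorem in [mvt_Re]. *)
Lemma numField_is_deriveP (K : numFieldType) (f : K -> K) (z d : K) :
  (forall e : K, 0 < e -> exists2 r : K, 0 < r & forall h, `|h| < r ->
    `|f (z + h) - f z - d * h| <= e * `|h|) <->
  is_derive (z : K^o) 1 (f : K^o -> K^o) d.
Proof.
have E : (fun h : K => h^-1 *: (((f : K^o -> K^o) \o shift z) (h *: (1 : K^o)) - f z))
   = (fun h => h^-1 *: ((f : K^o -> K^o) (h + z) - f z)).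
  by apply/funext => h /=; rewrite /GRing.scale /= mulr1.
split=> [/numField_derivP H|[H1 H2]].
  split; first by rewrite /derivable E; apply/cvg_ex; exists d.
  by rewrite /derive E; apply: cvg_lim; [exact: norm_hausdorff|exact: H].
apply/numField_derivP; rewrite -E -H2; exact: H1.
Qed.

Section EpsilonDeltaDerivative.
Variable R : realType.
Implicit Types (f g : R[i] -> R[i]) (z d : R[i]).

(** Real eps and del replace the positive elements of R[i] that its norm calls for, and the error is
    compared with [nrm h] rather than divided by h, so h = 0 is no exception. *)
Definition deriv_at f z d := forall eps : R, 0 < eps ->
  exists2 del : R, 0 < del & forall h, nrm h < del ->
    nrm (f (z + h) - f z - d * h) <= eps * nrm h.

Definition cont_at f z := forall eps : R, 0 < eps ->
  exists2 del : R, 0 < del & forall h, nrm h < del -> nrm (f (z + h) - f z) <= eps.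

Lemma Cpos (e : R[i]) : 0 < e -> exists2 r : R, 0 < r & e = (r%:C)%C.
Proof.
case: e => a b; rewrite ltcE /= => /andP[/eqP -> a0]; by exists a.
Qed.

Lemma deriv_atP f z d :
  deriv_at f z d <-> is_derive (z : R[i]^o) 1 (f : R[i]^o -> R[i]^o) d.
Proof.
have P := @numField_is_deriveP (R[i] : numFieldType) f z d.
split=> [H|/P H e]; [apply/P => e|].
  move=> /Cpos[r r0 ->]; have [s s0 Hs] := H r r0.
  exists (s%:C)%C => [|h]; first by rewrite -[0]/((0%:C)%C) ltcR.
  by rewrite !normC_nrm -rmorphM ltcR lecR; exact: Hs.
move=> e0; have /H[_ /Cpos[s s0 ->] Hs] : 0 < (e%:C)%C by rewrite -[0]/((0%:C)%C) ltcR.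
exists s => // h; have := Hs h.
by rewrite !normC_nrm -rmorphM ltcR lecR.
Qed.

Lemma deriv_at_derive1 f z d : deriv_at f z d ->
  derivable (f : R[i]^o -> R[i]^o) z 1 /\ dC f z = d.
Proof.
move=> /deriv_atP[h1 h2]; split; first exact: h1.
exact: etrans (@derive1E _ R[i]^o f z) h2.
Qed.

Lemma derivable_deriv_at f z :
  derivable (f : R[i]^o -> R[i]^o) z 1 -> deriv_at f z (dC f z).
Proof.
move=> H; apply/deriv_atP; split; first exact: H.
exact: esym (@derive1E _ R[i]^o f z).
Qed.

Lemma deriv_at_unique f z d d' : deriv_at f z d -> deriv_at f z d' -> d = d'.
Proof. by move=> /deriv_at_derive1[_ <-] /deriv_at_derive1[_ <-]. Qed.

Lemma deriv_at_eq f z d d' : deriv_at f z d -> d = d' -> deriv_at f z d'.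
Proof. by move=> ? <-. Qed.

Lemma deriv_at_local f g z d (r : R) : 0 < r ->
  (forall h, nrm h < r -> f (z + h) = g (z + h)) ->
  deriv_at f z d -> deriv_at g z d.
Proof.
move=> r0 fg H eps /H[del del0 Hd].
exists (Num.min r del) => [|h]; first by rewrite lt_min r0.
rewrite lt_min => /andP[hr /Hd]; rewrite fg //.
by rewrite -{2}(addr0 z) fg ?nrm0 // addr0.
Qed.

Lemma deriv_at_cst c z : deriv_at (fun=> c) z 0.
Proof. by apply/deriv_atP; exact: is_derive_cst. Qed.

Lemma deriv_at_id z : deriv_at id z 1.
Proof. by apply/deriv_atP; exact: is_derive_id. Qed.

Lemma deriv_atD f g z d e :
  deriv_at f z d -> deriv_at g z e -> deriv_at (fun x => f x + g x) z (d + e).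
Proof. by rewrite !deriv_atP => ? ?; exact: is_deriveD. Qed.

Lemma deriv_atN f z d : deriv_at f z d -> deriv_at (fun x => - f x) z (- d).
Proof. by rewrite !deriv_atP => ?; exact: is_deriveN. Qed.

Lemma deriv_atB f g z d e :
  deriv_at f z d -> deriv_at g z e -> deriv_at (fun x => f x - g x) z (d - e).
Proof. by rewrite !deriv_atP => ? ?; exact: is_deriveB. Qed.

Lemma deriv_atM f g z d e : deriv_at f z d -> deriv_at g z e ->
  deriv_at (fun x => f x * g x) z (f z * e + g z * d).
Proof. by rewrite !deriv_atP => ? ?; exact: is_deriveM. Qed.

Lemma deriv_at_cont f z d : deriv_at f z d -> cont_at f z.
Proof.
move=> /(_ 1 ltr01)[del del0 H] eps eps0.
have d1 : 0 < nrm d + 1 by rewrite ltr_wpDl // nrm_ge0.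
exists (Num.min del (eps / (nrm d + 1))) => [|h].
  by rewrite lt_min del0 divr_gt0.
rewrite lt_min ltr_pdivlMr // => /andP[/H]; rewrite mul1r => h1 h2.
have := nrm_split (f (z + h) - f z) (d * h); rewrite nrmM => h3.
apply/ltW/(le_lt_trans _ h2); nra.
Qed.

Lemma deriv_at_comp f g z d e :
  deriv_at g z d -> deriv_at f (g z) e -> deriv_at (fun x => f (g x)) z (e * d).
Proof.
move=> Hg Hf eps eps0.
have e1 : 0 < nrm e + 1 by rewrite ltr_wpDl // nrm_ge0.
have d1 : 0 < nrm d + 1 by rewrite ltr_wpDl // nrm_ge0.
have [r r0 Hr] := Hf _ (divr_gt0 (divr_gt0 eps0 (ltr0n R 2)) d1).
have m0 : 0 < Num.min 1 (eps / 2 / (nrm e + 1)) by rewrite lt_min ltr01 !divr_gt0.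
have [s s0 Hs] := Hg _ m0.
have [t t0 Ht] := deriv_at_cont Hg (divr_gt0 r0 (ltr0n R 2)).
exists (Num.min s t) => [|h]; first by rewrite lt_min s0.
rewrite lt_min => /andP[/Hs Hh1 /Ht Hh2].
set k := g (z + h) - g z in Hh1 Hh2.
have /Hr : nrm k < r by apply: le_lt_trans Hh2 _; rewrite ltr_pdivrMr // ltr_pMr // ltr1n.
have -> : g z + k = g (z + h) by rewrite /k addrC subrK.
move=> Hk.
have h0 := nrm_ge0 h.
have kb : nrm k <= (nrm d + 1) * nrm h.
  apply: le_trans (nrm_split _ (d * h)) _.
  rewrite nrmM mulrDl mul1r addrC lerD2l.
  by apply: le_trans Hh1 _; rewrite ler_piMl // ge_min lexx.
have Hh1' : nrm (k - d * h) <= eps / 2 / (nrm e + 1) * nrm h.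
  by apply: le_trans Hh1 _; rewrite ler_wpM2r // ge_min lexx orbT.
have -> : f (g (z + h)) - f (g z) - e * d * h =
   (f (g (z + h)) - f (g z) - e * k) + e * (k - d * h) by ring.
apply: le_trans (nrmD _ _) _; rewrite nrmM.
have -> : eps * nrm h = eps / 2 * nrm h + eps / 2 * nrm h by field.
apply: lerD.
  apply: le_trans Hk _.
  have -> : eps / 2 * nrm h = eps / 2 / (nrm d + 1) * ((nrm d + 1) * nrm h).
    by rewrite mulrA divfK ?gt_eqF.
  by apply: ler_wpM2l kb; rewrite !divr_ge0 ?ltW.
apply: (@le_trans _ _ (nrm e * (eps / 2 / (nrm e + 1) * nrm h))).
  by rewrite ler_wpM2l ?nrm_ge0.
rewrite mulrA ler_wpM2r // mulrA ler_pdivrMr // mulrC ler_wpM2l ?divr_ge0 ?ltW //.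
by rewrite ltrDl.
Qed.

(** Caratheodory's form of the derivative, through a slope continuous at the point. With the
    converse [deriv_at_quotE] it carries differentiability from v to its square root in
    [deriv_at_sqrt]. *)
Lemma deriv_at_quot f z (q : R[i] -> R[i]) (r : R) : 0 < r -> cont_at q z ->
  (forall h, nrm h < r -> f (z + h) - f z = q (z + h) * h) -> deriv_at f z (q z).
Proof.
move=> r0 qc H eps /qc[del del0 Hd]; exists (Num.min r del) => [|h].
  by rewrite lt_min r0.
rewrite lt_min => /andP[hr /Hd Hq].
by rewrite H // -mulrBl nrmM ler_wpM2r ?nrm_ge0.
Qed.

Lemma deriv_at_quotE f z d : deriv_at f z d -> exists q : R[i] -> R[i],
  [/\ cont_at q z, q z = d & forall h, f (z + h) - f z = q (z + h) * h].
Proof.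
move=> H; exists (fun x => if x == z then d else (f x - f z) / (x - z)).
split; last 2 first.
- by rewrite eqxx.
- move=> h; have E : z + h - z = h by ring.
  case: eqVneq => [e|]; last by rewrite -subr_eq0 E => h0; rewrite divfK.
  move: E; rewrite e subrr => <-; by rewrite subrr mulr0.
move=> eps eps0; have [del del0 Hd] := H _ eps0; exists del => // h /Hd; rewrite eqxx.
case: eqVneq => [_ _|e]; first by rewrite subrr nrm0 ltW.
have h0 : h != 0 by apply: contraNneq e => ->; rewrite addr0.
have -> : z + h - z = h by ring.
have -> : (f (z + h) - f z) / h - d = (f (z + h) - f z - d * h) / h by field.
by rewrite nrmM nrmV ler_pdivrMr ?nrm_gt0.
Qed.

Lemma cont_atV f z : f z != 0 -> cont_at f z -> cont_at (fun x => (f x)^-1) z.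
Proof.
move=> f0 fc eps eps0; have n0 : 0 < nrm (f z) by rewrite nrm_gt0.
have e1 : 0 < Num.min (nrm (f z) / 2) (eps * nrm (f z) ^+ 2 / 2).
  by rewrite lt_min !divr_gt0 // mulr_gt0 // exprn_gt0.
have [del del0 Hd] := fc _ e1; exists del => // h /Hd.
rewrite le_min => /andP[h1 h2].
have h3 : nrm (f z) / 2 <= nrm (f (z + h)).
  by have := nrm_split (f z) (f (z + h)); rewrite nrmBC; lra.
have fh0 : f (z + h) != 0 by rewrite -nrm_gt0; lra.
have -> : (f (z + h))^-1 - (f z)^-1 = - (f (z + h) - f z) / (f (z + h) * f z).
  by field; rewrite f0 fh0.
rewrite nrmM nrmN nrmV nrmM ler_pdivrMr ?mulr_gt0 ?nrm_gt0 //.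
apply: le_trans h2 _.
have := mulr_ge0 (ltW (mulr_gt0 eps0 n0)) (_ : 0 <= nrm (f (z + h)) - nrm (f z) / 2).
rewrite subr_ge0 => /(_ h3); lra.
Qed.

Lemma deriv_atV f z d : f z != 0 -> deriv_at f z d ->
  deriv_at (fun x => (f x)^-1) z (- d / f z ^+ 2).
Proof.
rewrite !deriv_atP => f0 [df fd]; split; first exact: derivableV.
by rewrite deriveV // fd /GRing.scale /= mulNr mulNr mulrC.
Qed.

End EpsilonDeltaDerivative.

(** * Limits along an ultrafilter *)

Section UltraLimit.
Variable R : realType.
Implicit Types (x y : nat -> R[i]) (l m : R[i]).

(** An ultrafilter finer than the eventual filter: every bounded sequence converges along it, and
    ordinary limits are preserved. *)
Definition nat_ultra : set_system nat :=
  sval (cid (ultraFilterLemma eventually_filter)).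

Lemma nat_ultraP : UltraFilter nat_ultra.
Proof. by rewrite /nat_ultra; case: cid => ? []. Qed.

#[global] Instance nat_ultra_proper : ProperFilter nat_ultra.
Proof. by have [] := nat_ultraP. Qed.

Lemma nat_ultra_ge n0 : nat_ultra [set n | (n0 <= n)%N]%classic.
Proof.
rewrite /nat_ultra; case: cid => U /= [_]; apply; by exists n0.
Qed.

Definition ucvg x l := forall eps : R, 0 < eps ->
  nat_ultra [set n | nrm (x n - l) <= eps]%classic.

Lemma nat_ultra_real_lim (y : nat -> R) (B : R) : (forall n, `|y n| <= B) ->
  exists t : R, forall eps, 0 < eps -> nat_ultra [set n | `|y n - t| <= eps]%classic.
Proof.
move=> yB.
have [] := @segment_compact R (- B) B (fmap y nat_ultra) _ _.
  rewrite /fmap /=; apply: filterS filterT => n _ /=.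
  by rewrite in_itv /= -ler_norml.
move=> l [_ Hl]; exists l => eps eps0.
(* Compactness gives only a cluster point l. An ultrafilter contains each set or its complement, and
   the complement would keep the sequence away from l. *)
case: (in_ultra_setVsetC [set n | `|y n - l| <= eps]%classic nat_ultraP) => // H.
have [] := Hl [set t | ~~ (`|t - l| <= eps)]%classic (ball l eps).
- rewrite /fmap /=; apply: filterS H => n /=; by move/negP.
- exact: nbhsx_ballx.
move=> t [/negP Ht]; rewrite -ball_normE /= distrC => /ltW Ht'; exact: False_ind (Ht Ht').
Qed.

Lemma ucvg_ex x (B : R) : (forall n, nrm (x n) <= B) -> exists l, ucvg x l.
Proof.
move=> xB.
have [a Ha] := nat_ultra_real_lim (fun n => le_trans (Re_le_nrm _) (xB n)).
have [b Hb] := nat_ultra_real_lim (fun n => le_trans (Im_le_nrm _) (xB n)).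
exists (a +i* b)%C => eps eps0.
have e2 : 0 < eps / 2 by rewrite divr_gt0.
apply: filterS (filterI (Ha _ e2) (Hb _ e2)) => n /= [h1 h2].
apply: le_trans (nrm_le_ReIm _) _.
move: h1 h2; case: (x n) => u v /= h1 h2; lra.
Qed.

Lemma ucvg_le x l (B : R) : ucvg x l ->
  nat_ultra [set n | nrm (x n) <= B]%classic -> nrm l <= B.
Proof.
move=> xl xB; apply/ler_addgt0Pr => e e0.
have [n /= [h1 h2]] := filter_ex (filterI (xl _ e0) xB).
by have := nrm_split l (x n); rewrite nrmBC => h3; lra.
Qed.

Lemma ucvg_Re_ge x l : ucvg x l -> (forall n, 0 <= complex.Re (x n)) -> 0 <= complex.Re l.
Proof.
move=> xl x0; apply/ler_addgt0Pr => e e0.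
have [n /= h1] := filter_ex (xl _ e0).
have := Re_le_nrm (x n - l); rewrite ReB ler_norml; have := x0 n; lra.
Qed.

Lemma ucvg_cst l : ucvg (fun=> l) l.
Proof. by move=> e e0; apply: filterS filterT => n _ /=; rewrite subrr nrm0 ltW. Qed.

Lemma ucvgD x y l m : ucvg x l -> ucvg y m -> ucvg (fun n => x n + y n) (l + m).
Proof.
move=> xl ym e e0; have e2 : 0 < e / 2 by rewrite divr_gt0.
apply: filterS (filterI (xl _ e2) (ym _ e2)) => n /= [h1 h2].
have -> : x n + y n - (l + m) = (x n - l) + (y n - m) by ring.
by apply: le_trans (nrmD _ _) _; lra.
Qed.

Lemma ucvgZ c x l : ucvg x l -> ucvg (fun n => c * x n) (c * l).
Proof.
move=> xl e e0; have c1 : 0 < nrm c + 1 by rewrite ltr_wpDl // nrm_ge0.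
apply: filterS (xl _ (divr_gt0 e0 c1)) => n /=; rewrite ler_pdivlMr // => h.
rewrite -mulrBr nrmM; have := nrm_ge0 (x n - l); nra.
Qed.

Lemma ucvgB x y l m : ucvg x l -> ucvg y m -> ucvg (fun n => x n - y n) (l - m).
Proof.
move=> xl ym; have := ucvgD xl (ucvgZ (-1) ym); rewrite mulN1r.
by congr ucvg; apply/funext => n; rewrite mulN1r.
Qed.

Lemma ucvg_unique x l m : ucvg x l -> ucvg x m -> l = m.
Proof.
move=> xl xm; apply/eqP; rewrite -subr_eq0 -nrm_eq0 eq_le nrm_ge0 andbT.
have h := ucvgB xl xm; apply: (ucvg_le h).
by apply: filterS filterT => n _ /=; rewrite subrr nrm0.
Qed.

Lemma ucvg_eventually x l :
  (forall eps : R, 0 < eps -> exists n0, forall n, (n0 <= n)%N -> nrm (x n - l) <= eps) ->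
  ucvg x l.
Proof.
move=> H e /H[n0 Hn]; apply: filterS (nat_ultra_ge n0) => n /=; exact: Hn.
Qed.

(** Total thanks to the default 0; boundedness ([ulimP]) or a known limit ([ulimE]) makes the value
    meaningful. *)
Definition ulim x : R[i] := xget 0 (ucvg x).

Lemma ulimP x (B : R) : (forall n, nrm (x n) <= B) -> ucvg x (ulim x).
Proof. by move=> /ucvg_ex[l xl]; rewrite /ulim; case: xgetP => [m -> //|/(_ l)]. Qed.

Lemma ulimE x l : ucvg x l -> ulim x = l.
Proof.
move=> xl; apply: ucvg_unique (xl); rewrite /ulim.
by case: xgetP => [m -> //|/(_ l)].
Qed.

End UltraLimit.

(** * Means over circles *)

Section CircleMean.
Variable R : realType.
Implicit Types (h g F : R[i] -> R[i]) (e z : R[i]) (r : R).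

(** Primitive 2^(n+1)-th roots of unity. Choosing principal square roots, whose real part is
    nonnegative, makes them tend to 1. *)
Fixpoint rtu (n : nat) : R[i] := if n is m.+1 then sqrtc (rtu m) else -1.

Lemma Re_sqrtc_ge0 z : 0 <= complex.Re (sqrtc z).
Proof. by case: z => a b /=; exact: sqrtr_ge0. Qed.

Lemma rtu_pow n : rtu n ^+ (2 ^ n) = -1.
Proof. by elim: n => [|n IH] //; rewrite expnS exprM sqr_sqrtc. Qed.

Lemma rtu_pow2 n : rtu n ^+ (2 ^ n.+1) = 1.
Proof. by rewrite expnS mulnC exprM rtu_pow sqrrN expr1n. Qed.

Lemma nrm_rtu n : nrm (rtu n) = 1.
Proof.
elim: n => [|n IH]; first by rewrite -[rtu 0]/(-1 : R[i]) nrmN nrm1.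
rewrite -[rtu n.+1]/(sqrtc (rtu n)).
apply/eqP; rewrite -(eqrXn2 (ltn0Sn 1) (nrm_ge0 _) ler01) -nrmX sqr_sqrtc.
by rewrite IH expr1n.
Qed.

Lemma rtu_neq1 n : rtu n - 1 != 0.
Proof.
rewrite subr_eq0; apply/eqP => H; have := rtu_pow n; rewrite H expr1n => /eqP.
by rewrite -subr_eq0 opprK -(natrD _ 1 1) pnatr_eq0.
Qed.

(** If w^2 = v with |w| = 1 and Re w >= 0, then |w + 1|^2 = 2 + 2 Re w >= 2, so v - 1 = (w - 1)(w +
    1) shows that each square root at least halves the squared distance to 1, which starts at 4. *)
Lemma rtu_cvg1_aux n : nrm (rtu n - 1) ^+ 2 <= 4 / 2 ^+ n.
Proof.
elim: n => [|n IH];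
  have E : rtu 0 - 1 = - (2%:R : R[i]) by rewrite /=; ring.
  by rewrite (congr1 (fun z => nrm z) E) nrmN nrm_nat expr0; lra.
set w := rtu n.+1; have w2 : w ^+ 2 = rtu n by exact: sqr_sqrtc.
have fact : nrm (w - 1) ^+ 2 * nrm (w + 1) ^+ 2 = nrm (rtu n - 1) ^+ 2.
  by rewrite -exprMn -nrmM -w2; congr (nrm _ ^+ 2); ring.
have w1 : 2 <= nrm (w + 1) ^+ 2.
  have := sqr_nrm w; rewrite nrm_rtu sqr_nrm.
  have := Re_sqrtc_ge0 (rtu n); rewrite -/(rtu n.+1) -/w.
  by case: w {w2 fact} => a b /= ha hb; nra.
have := nrm_ge0 (w - 1) => w0.
have -> : 4 / 2 ^+ n.+1 = 2^-1 * (4 / 2 ^+ n) :> R by rewrite [2 ^+ n.+1]exprS invfM mulrCA.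
rewrite ler_pdivlMl //; apply: le_trans IH; rewrite -fact mulrC.
by rewrite ler_wpM2l // exprn_ge0.
Qed.

Lemma rtu_cvg1 (del : R) : 0 < del ->
  exists n0, forall n, (n0 <= n)%N -> nrm (rtu n - 1) < del.
Proof.
move=> d0; have d2 : 0 < del ^+ 2 by rewrite exprn_gt0.
exists (Num.truncn (4 / del ^+ 2)).+1 => n hn.
rewrite -(ltr_pXn2r (ltn0Sn 1)) ?nnegrE ?nrm_ge0 ?(ltW d0) //.
apply: le_lt_trans (rtu_cvg1_aux n) _.
rewrite ltr_pdivrMr ?exprn_gt0 // mulrC -ltr_pdivrMr //.
apply: lt_le_trans (truncnS_gt _) _.
rewrite -natrX ler_nat; apply: leq_trans hn _.
by apply: ltnW; exact: ltn_expl.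
Qed.

Definition cmean r n h : R[i] :=
  (2 ^ n.+1)%:R^-1 * \sum_(0 <= j < 2 ^ n.+1) h ((r%:C)%C * rtu n ^+ j).

Definition mean r h : R[i] := ulim (fun n => cmean r n h).

(** Boundedness on the circle makes [mean] a genuine limit, hence linear; this is the side condition
    of the lemmas below. *)
Definition cbnd r h := exists B, forall e, nrm e = r -> nrm (h e) <= B.

Lemma nrm_circle r n j : 0 <= r -> nrm ((r%:C)%C * rtu n ^+ j) = r.
Proof. by move=> r0; rewrite nrmM nrmX nrm_rtu expr1n mulr1 nrmR ger0_norm. Qed.

Lemma cmean_le r n h (B : R) : 0 <= r ->
  (forall e, nrm e = r -> nrm (h e) <= B) -> nrm (cmean r n h) <= B.
Proof.
move=> r0 hB; have N0 : (0 : R) < (2 ^ n.+1)%:R by rewrite ltr0n expn_gt0.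
rewrite /cmean nrmM nrmV nrm_nat ler_pdivrMl //.
apply: le_trans (nrm_sum _ _ _) _.
apply: (@le_trans _ _ (\sum_(0 <= j < 2 ^ n.+1) B)).
  by apply: ler_sum => j _; apply: hB; exact: nrm_circle.
by rewrite sumr_const_nat subn0 -[B *+ _]mulr_natl.
Qed.

Lemma eq_cmean r n h g : 0 <= r -> (forall e, nrm e = r -> h e = g e) ->
  cmean r n h = cmean r n g.
Proof.
move=> r0 hg; rewrite /cmean; congr (_ * _).
by apply: eq_bigr => j _; apply: hg; exact: nrm_circle.
Qed.

Lemma cmeanD r n h g : cmean r n (fun e => h e + g e) = cmean r n h + cmean r n g.
Proof. by rewrite /cmean big_split mulrDr. Qed.

Lemma cmeanZ r n c h : cmean r n (fun e => c * h e) = c * cmean r n h.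
Proof. by rewrite /cmean -mulr_sumr mulrCA. Qed.

Lemma mean_cvg r h : 0 <= r -> cbnd r h -> ucvg (fun n => cmean r n h) (mean r h).
Proof.
by move=> r0 [B hB]; apply: (@ulimP _ _ B) => n; exact: cmean_le.
Qed.

Lemma eq_mean r h g : 0 <= r -> (forall e, nrm e = r -> h e = g e) ->
  mean r h = mean r g.
Proof.
by move=> r0 hg; rewrite /mean; congr ulim; apply/funext => n; exact: eq_cmean.
Qed.

Lemma meanD r h g : 0 <= r -> cbnd r h -> cbnd r g ->
  mean r (fun e => h e + g e) = mean r h + mean r g.
Proof.
move=> r0 hb gb; apply: ulimE.
under eq_fun do rewrite cmeanD.
by apply: ucvgD; exact: mean_cvg.
Qed.

Lemma meanZ r c h : 0 <= r -> cbnd r h -> mean r (fun e => c * h e) = c * mean r h.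
Proof.
move=> r0 hb; apply: ulimE; under eq_fun do rewrite cmeanZ.
by apply: ucvgZ; exact: mean_cvg.
Qed.

Lemma meanB r h g : 0 <= r -> cbnd r h -> cbnd r g ->
  mean r (fun e => h e - g e) = mean r h - mean r g.
Proof.
move=> r0 hb gb; have [B hB] := gb.
rewrite -mulN1r -meanZ // -meanD //.
  by apply: eq_mean => // e _; rewrite mulN1r.
by exists B => e /hB; rewrite mulN1r nrmN.
Qed.

Lemma mean_cst r c : 0 <= r -> mean r (fun=> c) = c.
Proof.
move=> r0; apply: ulimE => e e0; apply: filterS filterT => n _ /=.
rewrite /cmean sumr_const_nat subn0 -[c *+ _]mulr_natl mulKf ?subrr ?nrm0 ?ltW //.
Qed.

Lemma mean_le r h (B : R) : 0 <= r ->
  (forall e, nrm e = r -> nrm (h e) <= B) -> nrm (mean r h) <= B.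
Proof.
move=> r0 hB; apply: (ucvg_le (mean_cvg r0 _)); first by exists B.
by apply: filterS filterT => n _ /=; exact: cmean_le.
Qed.

Lemma mean_Re_ge0 r h : 0 <= r -> cbnd r h ->
  (forall e, nrm e = r -> 0 <= complex.Re (h e)) -> 0 <= complex.Re (mean r h).
Proof.
move=> r0 hb hp; apply: (ucvg_Re_ge (mean_cvg r0 hb)) => n.
have -> : cmean r n h = ((((2 ^ n.+1)%:R^-1 : R)%:C)%C *
    \sum_(0 <= j < 2 ^ n.+1) h ((r%:C)%C * rtu n ^+ j)).
  by rewrite /cmean fmorphV rmorph_nat.
rewrite ReZ mulr_ge0 ?invr_ge0 //.
elim/big_ind : _ => // [x y|j _]; first by rewrite ReD; exact: addr_ge0.
by apply: hp; exact: nrm_circle.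
Qed.

(* On the 2^(n+1)-th roots of unity the sum of the increments of F telescopes to 0,
   and it is close to the sum of F'(e) e times the small step (rtu n - 1). *)
Lemma mean_deriv_eq0 r F (F' : R[i] -> R[i]) : 0 < r ->
  (forall eps : R, 0 < eps -> exists2 del : R, 0 < del &
    forall a b, nrm a = r -> nrm b = r -> nrm (b - a) < del ->
      nrm (F b - F a - F' a * (b - a)) <= eps * nrm (b - a)) ->
  mean r (fun e => F' e * e) = 0.
Proof.
move=> r0 H; apply: ulimE; apply: ucvg_eventually => eps eps0.
have [del del0 Hd] := H _ (divr_gt0 eps0 r0).
have [n0 Hn] := rtu_cvg1 (divr_gt0 del0 r0).
exists n0 => n /Hn; rewrite ltr_pdivlMr // => wd.
set w := rtu n; set P := (2 ^ n.+1)%N; set p := fun j => (r%:C)%C * w ^+ j.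
have P0 : (0 : R) < P%:R by rewrite ltr0n expn_gt0.
have pr j : nrm (p j) = r by rewrite nrm_circle // ltW.
have step j : p j.+1 - p j = p j * (w - 1) by rewrite /p exprS; ring.
have stepn j : nrm (p j.+1 - p j) = nrm (w - 1) * r by rewrite step nrmM pr mulrC.
rewrite subr0 /cmean -/w -/P -/(p _) nrmM nrmV nrm_nat ler_pdivrMl //.
have w0 : 0 < nrm (w - 1) by rewrite nrm_gt0 rtu_neq1.
rewrite -(ler_pM2l w0) -nrmM.
have -> : (w - 1) * (\sum_(0 <= j < P) F' (p j) * p j) =
    - \sum_(0 <= j < P) (F (p j.+1) - F (p j) - F' (p j) * (p j.+1 - p j)).
  have tel : \sum_(0 <= j < P) (F (p j.+1) - F (p j)) = 0.
    by rewrite (telescope_sumr (fun j => F (p j))) // /p rtu_pow2 expr0 subrr.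
  rewrite [in RHS]sumrB tel sub0r opprK mulr_sumr; apply: eq_bigr => j _.
  rewrite step; ring.
rewrite nrmN; apply: le_trans (nrm_sum _ _ _) _.
apply: (@le_trans _ _ (\sum_(0 <= j < P) eps * nrm (w - 1))).
  apply: ler_sum => j _; apply: le_trans (Hd _ _ (pr _) (pr _) _) _.
    by rewrite stepn.
  by rewrite stepn mulrA mulrAC divfK ?gt_eqF.
rewrite sumr_const_nat subn0 -[(eps * _) *+ _]mulr_natl.
by rewrite le_eqVlt; apply/orP; left; apply/eqP; ring.
Qed.

End CircleMean.

(** * Mean value theorem and uniform differentiability *)

Section MeanValue.
Variable R : realType.
Implicit Types (f g : R[i] -> R[i]) (x y z : R[i]).

Lemma nrm_segment (rho t : R) x y : nrm x < rho -> nrm y < rho -> 0 <= t <= 1 ->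
  nrm (x + (t%:C)%C * (y - x)) < rho.
Proof.
move=> xr yr /andP[t0 t1].
have -> : x + (t%:C)%C * (y - x) = ((1 - t)%:C)%C * x + (t%:C)%C * y.
  by rewrite rmorphB rmorph1; ring.
apply: le_lt_trans (nrmD _ _) _; rewrite !nrmM !nrmR !ger0_norm ?subr_ge0 //.
have [xy|/ltW yx] := leP (nrm x) (nrm y).
  by apply: le_lt_trans yr; nra.
by apply: le_lt_trans xr; nra.
Qed.

(** The mean value theorem fails for complex values but holds for the real function t -> Re(k f(x +
    t(y - x))). The multiplier k selects a direction: the conjugate of the increment of f gives
    [mvt_ineq], that of y - x gives univalence. *)
Lemma mvt_Re (rho : R) f (f' : R[i] -> R[i]) (k x y : R[i]) :
  (forall z, nrm z < rho -> deriv_at f z (f' z)) -> nrm x < rho -> nrm y < rho ->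
  exists2 t : R, 0 <= t <= 1 &
    complex.Re (k * (f y - f x)) =
    complex.Re (k * (f' (x + (t%:C)%C * (y - x)) * (y - x))).
Proof.
move=> df xr yr.
pose p (t : R) := x + (t%:C)%C * (y - x).
pose h t := complex.Re (k * f (p t)).
pose h' t := complex.Re (k * (f' (p t) * (y - x))).
have dh t : 0 <= t <= 1 -> is_derive (t : R^o) 1 (h : R^o -> R^o) (h' t).
  move=> t01; apply/numField_is_deriveP => e e0.
  have c0 : 0 < nrm k * nrm (y - x) + 1 by rewrite ltr_wpDl // mulr_ge0 // nrm_ge0.
  have [r r0 Hr] := df _ (nrm_segment xr yr t01) _ (divr_gt0 e0 c0).
  have d0 : 0 < nrm (y - x) + 1 by rewrite ltr_wpDl // nrm_ge0.
  exists (r / (nrm (y - x) + 1)); first exact: divr_gt0.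
  move=> s; rewrite ltr_pdivlMr // => sr.
  have n0 := nrm_ge0 (y - x); have a0 := normr_ge0 s.
  have /Hr : nrm ((s%:C)%C * (y - x)) < r by rewrite nrmM nrmR; nra.
  rewrite -/(p t) nrmM nrmR.
  have -> : p t + (s%:C)%C * (y - x) = p (t + s) by rewrite /p rmorphD; ring.
  move=> H; rewrite /h /h'.
  have -> : complex.Re (k * f (p (t + s))) - complex.Re (k * f (p t)) -
      complex.Re (k * (f' (p t) * (y - x))) * s =
    complex.Re (k * (f (p (t + s)) - f (p t) - f' (p t) * ((s%:C)%C * (y - x)))).
    rewrite (mulrC _ s) -ReZ -!ReB; congr complex.Re; ring.
  apply: le_trans (Re_le_nrm _) _; rewrite nrmM.
  apply: le_trans (ler_wpM2l (nrm_ge0 k) H) _.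
  have -> : nrm k * (e / (nrm k * nrm (y - x) + 1) * (`|s| * nrm (y - x))) =
    (e * `|s|) * ((nrm k * nrm (y - x)) / (nrm k * nrm (y - x) + 1)).
    by field; exact: lt0r_neq0.
  rewrite ler_piMr ?mulr_ge0 ?(ltW e0) // ler_pdivrMr // mul1r lerDl //.
have [||t] := @MVT_segment R h h' 0 1 ler01 _ _.
- by move=> t; rewrite in_itv /= => /andP[/ltW t0 /ltW t1]; apply: dh; rewrite t0.
- apply: derivable_within_continuous => t; rewrite in_itv /= => t01.
  by have [] := dh t t01.
rewrite in_itv /= subr0 mulr1 => t01 E; exists t => //; rewrite -/(p t) -/(h' t) -E.
have p0 : p 0 = x by rewrite /p rmorph0; ring.
have p1 : p 1 = y by rewrite /p rmorph1; ring.
rewrite /h p0 p1 -ReB.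
by congr complex.Re; ring.
Qed.

(** Apply [mvt_Re] to f - c z with k the conjugate of its increment: the left side becomes the
    squared modulus of that increment, and one factor cancels. *)
Lemma mvt_ineq (rho eps : R) f (f' : R[i] -> R[i]) (c x y : R[i]) :
  (forall z, nrm z < rho -> deriv_at f z (f' z)) -> nrm x < rho -> nrm y < rho ->
  (forall t : R, 0 <= t <= 1 -> nrm (f' (x + (t%:C)%C * (y - x)) - c) <= eps) ->
  nrm (f y - f x - c * (y - x)) <= eps * nrm (y - x).
Proof.
move=> df xr yr H; set k := f y - f x - c * (y - x).
have dg z : nrm z < rho -> deriv_at (fun w => f w - c * w) z (f' z - c).
  move=> zr; apply: deriv_at_eq (deriv_atB (df z zr) (deriv_atM (deriv_at_cst c z) (deriv_at_id z))) _.
  ring.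
have [t /H Ht] := mvt_Re (k^*)%C dg xr yr.
have -> : f y - c * y - (f x - c * x) = k by rewrite /k; ring.
rewrite (mulrC _ k) Re_mul_conj => E.
have [->|k0] := eqVneq k 0; first by rewrite nrm0 mulr_ge0 ?nrm_ge0 // (le_trans (nrm_ge0 _) Ht).
have k1 : 0 < nrm k by rewrite nrm_gt0.
rewrite -(ler_pM2l k1) -expr2 E; apply: le_trans (ler_norm _) _.
apply: le_trans (Re_le_nrm _) _; rewrite !nrmM nrm_conj ler_wpM2l ?nrm_ge0 //.
by rewrite ler_wpM2r ?nrm_ge0.
Qed.

Definition C1 f (f' : R[i] -> R[i]) :=
  (forall z, nrm z < 1 -> deriv_at f z (f' z)) /\
  (forall z, nrm z < 1 -> cont_at f' z).

(* Compactness of the closed disc: limits along the ultrafilter of sequences in it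
   remain in it. *)
Lemma cont_unif (r : R) g : r < 1 -> (forall z, nrm z < 1 -> cont_at g z) ->
  forall eps : R, 0 < eps -> exists2 del : R, 0 < del &
    forall a b, nrm a <= r -> nrm b <= r -> nrm (b - a) < del -> nrm (g b - g a) <= eps.
Proof.
move=> r1 gc eps eps0; apply: contrapT => H.
have bad n : exists ab : R[i] * R[i], [/\ nrm ab.1 <= r, nrm ab.2 <= r,
    nrm (ab.2 - ab.1) < n.+1%:R^-1 & ~ (nrm (g ab.2 - g ab.1) <= eps)].
  apply: contrapT => Hn; apply: H; exists n.+1%:R^-1; first by rewrite invr_gt0.
  by move=> a b ar br ab; apply: contrapT => Hg; apply: Hn; exists (a, b).
have {}bad n := cid (bad n); pose a n := (sval (bad n)).1; pose b n := (sval (bad n)).2.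
have abP n : [/\ nrm (a n) <= r, nrm (b n) <= r,
    nrm (b n - a n) < n.+1%:R^-1 & ~ (nrm (g (b n) - g (a n)) <= eps)].
  by rewrite /a /b; case: (bad n).
have ar n : nrm (a n) <= r by have [] := abP n.
have [l al] := ucvg_ex ar.
have lr : nrm l <= r by apply: (ucvg_le al); apply: filterS filterT => n _ /=.
have e2 : 0 < eps / 2 by rewrite divr_gt0.
have [del del0 Hd] := gc l (le_lt_trans lr r1) _ e2.
have d3 : 0 < del / 3 by rewrite divr_gt0.
have [n [/= h1 h2]] := filter_ex (filterI (al _ d3) (nat_ultra_ge (Num.truncn (del / 3)^-1))).
have [_ _ h3] := abP n; apply.
have h4 : n.+1%:R^-1 < del / 3.
  rewrite invf_plt ?posrE //; apply: lt_le_trans (truncnS_gt _) _.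
  by rewrite ler_nat ltnS.
have {h3 h4} h5 := lt_trans h3 h4.
have ga : nrm (g (a n) - g l) <= eps / 2.
  rewrite -(subrK l (a n)) (addrC _ l); apply: Hd; lra.
have gb : nrm (g (b n) - g l) <= eps / 2.
  rewrite -(subrK l (b n)) (addrC _ l); apply: Hd.
  by have := nrm_dist3 (b n) (a n) l; lra.
by have := nrm_dist3 (g (b n)) (g l) (g (a n)); rewrite (nrmBC (g l)); lra.
Qed.

Lemma cont_bounded (r : R) g : r < 1 -> (forall z, nrm z < 1 -> cont_at g z) ->
  exists B : R, forall a, nrm a <= r -> nrm (g a) <= B.
Proof.
move=> r1 gc; apply: contrapT => H.
have bad (n : nat) : exists a : R[i], nrm a <= r /\ ~ (nrm (g a) <= n%:R).
  apply: contrapT => Hn; apply: H; exists n%:R => a ar.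
  by apply: contrapT => Hg; apply: Hn; exists a.
have {}bad n := cid (bad n); pose a n := sval (bad n).
have ar n : nrm (a n) <= r by rewrite /a; case: (bad n) => ? [].
have [l al] := ucvg_ex ar.
have lr : nrm l <= r by apply: (ucvg_le al); apply: filterS filterT => n _ /=.
have [del del0 Hd] := gc l (le_lt_trans lr r1) _ (@ltr01 R).
have d3 : 0 < del / 3 by rewrite divr_gt0.
have [n [/= h1 h2]] := filter_ex (filterI (al _ d3) (nat_ultra_ge (Num.truncn (nrm (g l) + 1)).+1)).
have [_] := svalP (bad n); apply; rewrite -/(a n).
have ga : nrm (g (a n) - g l) <= 1.
  rewrite -(subrK l (a n)) (addrC _ l); apply: Hd; lra.
have : nrm (g l) + 1 < n%:R by apply: lt_le_trans (truncnS_gt _) _; rewrite ler_nat.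
have := nrm_split (g (a n)) (g l); lra.
Qed.

(** Uniform continuity of f' on the closed disc, fed to [mvt_ineq] with c = f'(a), makes
    differentiability uniform in the base point, as [mean_deriv_eq0] requires. *)
Lemma C1_strict f f' (r : R) : C1 f f' -> r < 1 ->
  forall eps : R, 0 < eps -> exists2 del : R, 0 < del &
    forall a b, nrm a <= r -> nrm b <= r -> nrm (b - a) < del ->
      nrm (f b - f a - f' a * (b - a)) <= eps * nrm (b - a).
Proof.
move=> [df cf] r1 eps eps0; have [del del0 Hd] := cont_unif r1 cf eps0.
exists del => // a b ar br ab; apply: (mvt_ineq df).
- exact: le_lt_trans r1.
- exact: le_lt_trans r1.
move=> t t01; apply: Hd => //.
  by rewrite leNgt; apply/negP => hr; have := @nrm_segment _ t _ _ (le_lt_trans ar hr) (le_lt_trans br hr) t01; rewrite ltxx.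
rewrite addrC addKr nrmM nrmR; case/andP: t01 => t0 t1.
by rewrite ger0_norm //; apply: le_lt_trans ab; rewrite ler_piMl // nrm_ge0.
Qed.

End MeanValue.

(** * Cauchy's formula *)

Section CauchyFormula.
Variable R : realType.
Implicit Types (f g : R[i] -> R[i]) (x y z e : R[i]) (r : R).

Lemma nrm_segment_le (r t : R) x y : nrm x <= r -> nrm y <= r -> 0 <= t <= 1 ->
  nrm (x + (t%:C)%C * (y - x)) <= r.
Proof.
move=> xr yr t01; rewrite leNgt; apply/negP => hr.
by have := nrm_segment (le_lt_trans xr hr) (le_lt_trans yr hr) t01; rewrite ltxx.
Qed.

Lemma circle_sub_neq0 r z e : nrm z < r -> nrm e = r -> e - z != 0.
Proof. by move=> zr er; rewrite subr_eq0; apply: contraTneq zr => <-; rewrite er ltxx. Qed.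

Lemma circle_neq0 r e : 0 < r -> nrm e = r -> e != 0.
Proof. by move=> r0 er; rewrite -nrm_gt0 er. Qed.

Lemma nrm_kernel r z e : nrm z < r -> nrm e = r -> nrm (e / (e - z)) <= r / (r - nrm z).
Proof.
move=> zr er; rewrite nrmM nrmV er ler_wpM2l //; first by rewrite -er nrm_ge0.
rewrite lef_pV2 ?posrE ?subr_gt0 // -?er ?nrm_ler_sub //.
by rewrite nrm_gt0; apply: circle_sub_neq0 er.
Qed.

Lemma cbndM r f g : cbnd r f -> cbnd r g -> cbnd r (fun e => f e * g e).
Proof.
move=> [A fA] [B gB]; exists (A * B) => e er.
by rewrite nrmM ler_pM ?nrm_ge0 ?fA ?gB.
Qed.

Lemma cbndD r f g : cbnd r f -> cbnd r g -> cbnd r (fun e => f e + g e).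
Proof.
move=> [A fA] [B gB]; exists (A + B) => e er.
by apply: le_trans (nrmD _ _) _; rewrite lerD ?fA ?gB.
Qed.

Lemma cbnd_cst r c : cbnd r (fun=> c).
Proof. by exists (nrm c). Qed.

Lemma cbnd_id r : cbnd r id.
Proof. by exists r => e ->. Qed.

Lemma cbnd_inv r : cbnd r (fun e => e^-1).
Proof. by exists r^-1 => e; rewrite nrmV => ->. Qed.

Lemma cbndX r f k : cbnd r f -> cbnd r (fun e => f e ^+ k).
Proof.
move=> fb; elim: k => [|k IH]; first by exists 1 => e _; rewrite expr0 nrm1.
have [B hB] := cbndM fb IH; exists B => e er; rewrite exprS; exact: hB.
Qed.

Lemma cbnd_kernel r z : nrm z < r -> cbnd r (fun e => e / (e - z)).
Proof. by move=> zr; exists (r / (r - nrm z)) => e er; exact: nrm_kernel. Qed.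

Lemma C1_cont f f' : C1 f f' -> forall z, nrm z < 1 -> cont_at f z.
Proof. move=> [df _] z /df; exact: deriv_at_cont. Qed.

Lemma cbnd_C1 f f' r : C1 f f' -> r < 1 -> cbnd r f.
Proof.
move=> /C1_cont fc /cont_bounded/(_ fc)[B hB]; exists B => e er; apply: hB.
by rewrite er.
Qed.

(* The circle is contracted to z through e |-> z + t (e - z); the t-derivative of the
   mean is a mean of the form handled by [mean_deriv_eq0]. *)
Lemma C1_mean_kernel f f' r z : C1 f f' -> 0 < r < 1 -> nrm z < r ->
  mean r (fun e => f e * (e / (e - z))) = f z * mean r (fun e => e / (e - z)).
Proof.
move=> fC /andP[r0 r1] zr; have r0' := ltW r0.
pose pt (t : R) e := z + (t%:C)%C * (e - z).
have ptr t e : 0 <= t <= 1 -> nrm e = r -> nrm (pt t e) <= r.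
  by move=> t01 er; apply: nrm_segment_le => //; [exact: ltW|rewrite er].
pose Phi t := mean r (fun e => f (pt t e) * (e / (e - z))).
have [B fB] := cont_bounded r1 (C1_cont fC).
have [B' fB'] := cont_bounded r1 fC.2.
have kb := cbnd_kernel zr.
have Phib t : 0 <= t <= 1 -> cbnd r (fun e => f (pt t e) * (e / (e - z))).
  by move=> t01; apply: cbndM => //; exists B => e er; apply: fB; exact: ptr.
(* For t > 0, f'(pt t e) is the derivative in e of f(pt t e) / t; for t = 0 it is the constant
   f'(z), the derivative of a linear function. *)
have mean0 t : 0 <= t <= 1 -> mean r (fun e => f' (pt t e) * e) = 0.
  move=> t01; have /andP[t0 t1] := t01.
  have [->|tn0] := eqVneq t 0.
    rewrite -(@mean_deriv_eq0 _ r (fun e => f' z * e) (fun=> f' z)) //.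
      by apply: eq_mean => // e _; rewrite /pt rmorph0 mul0r addr0.
    move=> eps eps0; exists 1 => // a b _ _ _.
    by rewrite -mulrBr subrr nrm0 mulr_ge0 ?nrm_ge0 // ltW.
  have tp : 0 < t by rewrite lt_neqAle eq_sym tn0.
  have tC : (t%:C)%C != 0 by rewrite -nrm_gt0 nrmR ger0_norm.
  apply: (@mean_deriv_eq0 _ r (fun e => f (pt t e) / (t%:C)%C) (fun e => f' (pt t e))) => //.
  move=> eps eps0; have [del del0 Hd] := C1_strict fC r1 eps0.
  exists del => // a b ar br ab.
  have E : pt t b - pt t a = (t%:C)%C * (b - a) by rewrite /pt; ring.
  have -> : f (pt t b) / (t%:C)%C - f (pt t a) / (t%:C)%C - f' (pt t a) * (b - a) =
      (f (pt t b) - f (pt t a) - f' (pt t a) * (pt t b - pt t a)) / (t%:C)%C.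
    by rewrite E; field.
  rewrite nrmM nrmV nrmR ger0_norm // ler_pdivrMr //.
  have En : nrm (pt t b - pt t a) = t * nrm (b - a) by rewrite E nrmM nrmR ger0_norm.
  have -> : eps * nrm (b - a) * t = eps * nrm (pt t b - pt t a) by rewrite En; ring.
  apply: Hd; rewrite ?ptr // En; apply: le_lt_trans ab.
  by rewrite ler_piMl // nrm_ge0.
(* [0, 1] is cut into n equal pieces. Since |e - z| <= 2, the condition 2/n < del keeps each move of
   [pt] within the range of [C1_strict]. *)
have close eps : 0 < eps -> nrm (Phi 1 - Phi 0) <= eps * r.
  move=> eps0; have [del del0 Hd] := C1_strict fC r1 eps0.
  set n := (Num.truncn (2 / del)).+1.
  have n0 : (0 : R) < n%:R by rewrite ltr0n.
  have nd : 2 / n%:R < del.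
    by rewrite ltr_pdivrMr // mulrC -ltr_pdivrMr //; exact: truncnS_gt.
  have step k : (k < n)%N ->
      nrm (Phi (k.+1%:R / n%:R) - Phi (k%:R / n%:R)) <= eps * r / n%:R.
    move=> kn; set t := k%:R / n%:R; set t' := k.+1%:R / n%:R.
    have t01 : 0 <= t <= 1 by rewrite divr_ge0 //= ler_pdivrMr // mul1r ler_nat ltnW.
    have t'01 : 0 <= t' <= 1 by rewrite divr_ge0 //= ler_pdivrMr // mul1r ler_nat.
    have tt : t' = t + n%:R^-1 by rewrite /t /t' -natr1; ring.
    have fb' : cbnd r (fun e => f' (pt t e) * e).
      apply: cbndM (cbnd_id r); exists B' => e er; apply: fB'; exact: ptr.
    (* The first-order term has mean 0, so it can be subtracted at no cost. The factor e - z in the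
       increment of [pt] cancels the denominator of the kernel, leaving exactly f'(pt t e) e. *)
    have -> : Phi t' - Phi t = Phi t' - Phi t -
        ((n%:R^-1 : R)%:C)%C * mean r (fun e => f' (pt t e) * e).
      by rewrite mean0 // mulr0 subr0.
    have Pt := Phib _ t01; have Pt' := Phib _ t'01.
    rewrite /Phi -meanZ // -meanB // -meanB //; first last.
    - by apply: cbndM => //; exact: cbnd_cst.
    - have [A hA] := Phib _ t'01; have [A' hA'] := Phib _ t01.
      by exists (A + A') => e er; apply: le_trans (nrmB _ _) _; rewrite lerD ?hA ?hA'.
    apply: mean_le => // e er; have ez := circle_sub_neq0 zr er.
    have E : pt t' e - pt t e = ((n%:R^-1 : R)%:C)%C * (e - z).
      by rewrite /pt tt rmorphD; ring.
    have -> : f (pt t' e) * (e / (e - z)) - f (pt t e) * (e / (e - z)) -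
        ((n%:R^-1 : R)%:C)%C * (f' (pt t e) * e) =
      (f (pt t' e) - f (pt t e) - f' (pt t e) * (pt t' e - pt t e)) * (e / (e - z)).
      by rewrite E; move: ((n%:R^-1)%:C)%C => c; field.
    have En : nrm (pt t' e - pt t e) = nrm (e - z) / n%:R.
      by rewrite E nrmM nrmR ger0_norm ?invr_ge0 // mulrC.
    have nez : 0 < nrm (e - z) by rewrite nrm_gt0.
    have H : nrm (f (pt t' e) - f (pt t e) - f' (pt t e) * (pt t' e - pt t e)) <=
        eps * (nrm (e - z) / n%:R).
      rewrite -En; apply: Hd; rewrite ?ptr // En; apply: le_lt_trans nd.
      rewrite ler_pM2r ?invr_gt0 //; apply: le_trans (nrmB _ _) _; rewrite er; lra.
    rewrite nrmM; apply: le_trans (ler_wpM2r (nrm_ge0 _) H) _.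
    rewrite nrmM nrmV er le_eqVlt; apply/orP; left; apply/eqP; field.
    by rewrite !gt_eqF.
  have tel : Phi 1 - Phi 0 = \sum_(0 <= k < n) (Phi (k.+1%:R / n%:R) - Phi (k%:R / n%:R)).
    pose G k := Phi (k%:R / n%:R).
    have -> : Phi 1 = G n by rewrite /G divff // lt0r_neq0.
    have -> : Phi 0 = G 0%N by rewrite /G mul0r.
    by rewrite -telescope_sumr.
  rewrite tel; apply: le_trans (nrm_sum _ _ _) _.
  apply: (@le_trans _ _ (\sum_(0 <= k < n) (eps * r / n%:R))).
    by apply: ler_sum_nat => k /andP[_ kn]; exact: step.
  rewrite sumr_const_nat subn0 -[(_ / _) *+ _]mulr_natl mulrC divfK //.
  exact: lt0r_neq0.
have : Phi 1 = Phi 0.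
  apply/eqP; rewrite -subr_eq0 -nrm_eq0 eq_le nrm_ge0 andbT.
  apply/ler_addgt0Pr => eps eps0; rewrite add0r.
  by have := close _ (divr_gt0 eps0 r0); rewrite divfK // gt_eqF.
have -> : Phi 1 = mean r (fun e => f e * (e / (e - z))).
  by apply: eq_mean => // e _; rewrite /pt rmorph1 mul1r addrC subrK.
move=> ->; rewrite -meanZ //; apply: eq_mean => // e _.
by rewrite /pt rmorph0 mul0r addr0.
Qed.

Lemma mean_value f f' r : C1 f f' -> 0 < r < 1 -> mean r f = f 0.
Proof.
move=> fC r01; have /andP[r0 r1] := r01; have r0' := ltW r0.
have z0 : nrm (0 : R[i]) < r by rewrite nrm0.
have := C1_mean_kernel fC r01 z0.
rewrite (@eq_mean _ r (fun e => e / (e - 0)) (fun=> 1)) //.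
  rewrite mean_cst // mulr1 => <-; apply: eq_mean => // e er.
  by rewrite subr0 divff ?mulr1 ?(circle_neq0 r0).
by move=> e er; rewrite subr0 divff ?(circle_neq0 r0).
Qed.

Lemma deriv_atX n z : deriv_at (fun x => x ^+ n) z (n%:R * z ^+ n.-1).
Proof.
elim: n => [|n IH]; first by rewrite mul0r; exact: deriv_at_cst.
have := deriv_atM (deriv_at_id z) IH.
have -> : (fun x => id x * x ^+ n) = (fun x : R[i] => x ^+ n.+1).
  by apply/funext => x; rewrite exprS.
move/deriv_at_eq; apply => /=.
by case: n {IH} => [|n] /=; rewrite ?expr0 ?exprS -?natr1; ring.
Qed.

Lemma cont_atD f g z : cont_at f z -> cont_at g z -> cont_at (fun x => f x + g x) z.
Proof.
move=> fc gc eps eps0; have e2 : 0 < eps / 2 by rewrite divr_gt0.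
have [d1 d10 H1] := fc _ e2; have [d2 d20 H2] := gc _ e2.
exists (Num.min d1 d2) => [|h]; first by rewrite lt_min d10.
rewrite lt_min => /andP[/H1 h1 /H2 h2].
have -> : f (z + h) + g (z + h) - (f z + g z) = (f (z + h) - f z) + (g (z + h) - g z) by ring.
by apply: le_trans (nrmD _ _) _; lra.
Qed.

Lemma cont_atM f g z : cont_at f z -> cont_at g z -> cont_at (fun x => f x * g x) z.
Proof.
move=> fc gc eps eps0.
have F0 := nrm_ge0 (f z); have G0 := nrm_ge0 (g z).
have g1 : 0 < nrm (g z) + 1 by rewrite ltr_wpDl.
have f1 : 0 < nrm (f z) + 1 by rewrite ltr_wpDl.
have [d1 d10 H1] := fc _ (divr_gt0 (divr_gt0 eps0 (ltr0n R 2)) g1).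
have [d2 d20 H2] := gc _ (divr_gt0 (divr_gt0 eps0 (ltr0n R 2)) f1).
have [d3 d30 H3] := gc _ (@ltr01 R).
exists (Num.min d1 (Num.min d2 d3)) => [|h]; first by rewrite !lt_min d10 d20.
rewrite !lt_min => /and3P[/H1 + /H2 + /H3 h3]; rewrite !ler_pdivlMr // => h1 h2.
have -> : f (z + h) * g (z + h) - f z * g z =
  (f (z + h) - f z) * g (z + h) + f z * (g (z + h) - g z) by ring.
apply: le_trans (nrmD _ _) _; rewrite !nrmM.
have h4 := nrm_split (g (z + h)) (g z).
have a0 := nrm_ge0 (f (z + h) - f z); have b0 := nrm_ge0 (g (z + h) - g z).
nra.
Qed.

Lemma C1M f f' g g' : C1 f f' -> C1 g g' ->
  C1 (fun x => f x * g x) (fun x => f x * g' x + g x * f' x).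
Proof.
move=> fC gC; split=> z z1; first exact: deriv_atM (fC.1 _ z1) (gC.1 _ z1).
apply: cont_atD; apply: cont_atM.
- exact: C1_cont fC _ z1.
- exact: gC.2.
- exact: C1_cont gC _ z1.
- exact: fC.2.
Qed.

Lemma C1X n : C1 (fun x => x ^+ n) (fun x : R[i] => n%:R * x ^+ n.-1).
Proof.
split=> z _; first exact: deriv_atX.
exact: cont_atM (deriv_at_cont (deriv_at_cst _ _)) (deriv_at_cont (deriv_atX _ _)).
Qed.

Lemma mean_X_eq0 r n : 0 < r < 1 -> (0 < n)%N -> mean r (fun e => e ^+ n) = 0.
Proof. by move=> r01; case: n => // n _; rewrite (mean_value (C1X n.+1) r01) exprS mul0r. Qed.

Lemma mean_conj r f : 0 <= r -> cbnd r f ->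
  mean r (fun e => (f e)^*)%C = ((mean r f)^*)%C.
Proof.
move=> r0 fb; apply: ulimE => eps eps0.
apply: filterS (mean_cvg r0 fb eps0) => n /=; rewrite -nrm_conj.
rewrite -[X in _ -> X]/(is_true _); congr (nrm _ <= _).
rewrite rmorphB /cmean rmorphM rmorph_sum fmorphV rmorph_nat.
by congr (_ - _).
Qed.

Lemma circle_inv r e : 0 < r -> nrm e = r -> e^-1 = (((r ^+ 2)^-1)%:C)%C * (e^*)%C.
Proof.
move=> r0 er; have e0 := circle_neq0 r0 er; apply: (mulfI e0).
rewrite divff // mulrCA mul_conj er -rmorphM mulVf ?rmorph1 //.
by rewrite expf_neq0 // gt_eqF.
Qed.

(** On the circle 1/e is a real multiple of the conjugate of e, so negative powers reduce to
    positive ones by conjugation. *)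
Lemma mean_V_eq0 r n : 0 < r < 1 -> (0 < n)%N -> mean r (fun e => e^-1 ^+ n) = 0.
Proof.
move=> r01 n0; have /andP[r0 _] := r01; have r0' := ltW r0.
have cb : cbnd r (fun e : R[i] => e ^+ n) := cbndX n (cbnd_id r).
rewrite (@eq_mean _ r _ (fun e => ((((r ^+ 2)^-1)%:C)%C ^+ n) * ((e ^+ n)^*)%C)) //.
  rewrite meanZ // ?mean_conj // ?mean_X_eq0 // ?rmorph0 ?mulr0 //.
  by case: cb => B hB; exists B => e /hB; rewrite nrm_conj.
by move=> e er; rewrite (circle_inv r0 er) exprMn rmorphXn.
Qed.

Lemma geom_lt (q eps : R) : 0 <= q < 1 -> 0 < eps -> exists K, q ^+ K < eps.
Proof.
move=> /andP[q0 q1] eps0.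
have : ((fun n => q ^+ n) @ \oo --> (0 : R))%classic by apply: cvg_expr; rewrite ger0_norm.
move=> /cvgrPdist_lt/(_ _ eps0)[K _ /(_ K (leqnn K))].
by rewrite /= sub0r normrN ger0_norm ?exprn_ge0 //; exists K.
Qed.

(** The finite geometric identity for e/(e - z) = 1/(1 - z/e) leaves the exact remainder g(e) e/(e -
    z) (z/e)^K, so no limit is exchanged with the mean. It yields both the mean of the kernel (g =
    1) and the Taylor expansion (g = f). *)
Lemma mean_kernel_expand g r z (B : R) K : 0 < r < 1 -> nrm z < r ->
  (forall e, nrm e = r -> nrm (g e) <= B) ->
  nrm (mean r (fun e => g e * (e / (e - z))) -
       \sum_(0 <= k < K) mean r (fun e => g e * e^-1 ^+ k) * z ^+ k) <=
  B * (r / (r - nrm z)) * (nrm z / r) ^+ K.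
Proof.
move=> /andP[r0 r1] zr gB; have r0' := ltW r0.
have gb : cbnd r g by exists B.
have kb := cbnd_kernel zr.
have term k : cbnd r (fun e => g e * e^-1 ^+ k) := cbndM gb (cbndX k (cbnd_inv r)).
have sumb k : cbnd r (fun e => \sum_(0 <= j < k) z ^+ j * (g e * e^-1 ^+ j)).
  elim: k => [|k [A hA]]; first by exists 0 => e _; rewrite big_geq ?nrm0.
  have [A' hA'] := cbndM (cbnd_cst r (z ^+ k)) (term k).
  exists (A + A') => e er; rewrite big_nat_recr //=; apply: le_trans (nrmD _ _) _.
  by rewrite lerD ?hA ?hA'.
have -> : \sum_(0 <= k < K) mean r (fun e => g e * e^-1 ^+ k) * z ^+ k =
    mean r (fun e => \sum_(0 <= k < K) z ^+ k * (g e * e^-1 ^+ k)).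
  elim: K => [|K IH].
    rewrite big_geq // (@eq_mean _ r _ (fun=> 0)) ?mean_cst // => e _.
    by rewrite big_geq.
  rewrite big_nat_recr //= IH mulrC -meanZ // -meanD //.
    by apply: eq_mean => // e _; rewrite big_nat_recr.
  exact: cbndM (cbnd_cst r _) (term K).
rewrite -meanB //; last exact: cbndM.
apply: mean_le => // e er; have e0 := circle_neq0 r0 er; have ez := circle_sub_neq0 zr er.
have -> : g e * (e / (e - z)) - \sum_(0 <= k < K) z ^+ k * (g e * e^-1 ^+ k) =
    g e * (e / (e - z)) * (z / e) ^+ K.
  elim: K => [|K IH]; first by rewrite big_geq // subr0 expr0 mulr1.
  rewrite big_nat_recr //= opprD addrA IH exprS !exprMn; field.
  by rewrite e0.
rewrite nrmM nrmX [nrm (z / e)]nrmM nrmV er; apply: ler_wpM2r.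
  by rewrite exprn_ge0 // divr_ge0 ?nrm_ge0.
by rewrite nrmM; apply: ler_pM; rewrite ?nrm_ge0 ?gB ?nrm_kernel.
Qed.

(** In the expansion with g = 1 only the term k = 0 survives; [K.+1] ensures that this term is
    present. *)
Lemma mean_kernel1 r z : 0 < r < 1 -> nrm z < r -> mean r (fun e => e / (e - z)) = 1.
Proof.
move=> r01 zr; have /andP[r0 _] := r01; have r0' := ltW r0.
have g1 e : nrm e = r -> nrm (1 : R[i]) <= 1 by rewrite nrm1.
have H K := mean_kernel_expand K.+1 r01 zr g1.
have c0 : 0 < r / (r - nrm z) by rewrite divr_gt0 // subr_gt0.
apply/eqP; rewrite -subr_eq0 -nrm_eq0 eq_le nrm_ge0 andbT.
apply/ler_addgt0Pr => eps eps0; rewrite add0r.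
have q1 : 0 <= nrm z / r < 1 by rewrite divr_ge0 ?nrm_ge0 //= ltr_pdivrMr // mul1r.
have [K qK] := geom_lt q1 (divr_gt0 eps0 c0).
have E0 : mean r (fun e => 1 * e^-1 ^+ 0) = 1.
  by rewrite (@eq_mean _ r _ (fun=> 1)) ?mean_cst // => e _; rewrite expr0 mulr1.
have E1 k : mean r (fun e => 1 * e^-1 ^+ k.+1) = 0.
  rewrite (@eq_mean _ r _ (fun e => e^-1 ^+ k.+1)) ?mean_V_eq0 // => e _.
  by rewrite mul1r.
have Es : \sum_(0 <= k < K.+1) mean r (fun e => 1 * e^-1 ^+ k) * z ^+ k = 1.
  rewrite big_nat_recl // E0 expr0 mulr1 big1 ?addr0 // => k _.
  by rewrite E1 mul0r.
have := H K; rewrite Es (@eq_mean _ r _ (fun e => e / (e - z))) //; last first.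
  by move=> e _; rewrite mul1r.
move/le_trans; apply; rewrite mul1r.
move: qK; rewrite ltr_pdivlMr // mulrC => /ltW; apply: le_trans.
rewrite ler_pM2l // exprS ler_piMl ?exprn_ge0 //.
  by case/andP: q1.
by case/andP: q1 => _ /ltW.
Qed.

Lemma cauchy_formula f f' r z : C1 f f' -> 0 < r < 1 -> nrm z < r ->
  mean r (fun e => f e * (e / (e - z))) = f z.
Proof.
by move=> fC r01 zr; rewrite (C1_mean_kernel fC r01 zr) mean_kernel1 ?mulr1.
Qed.

End CauchyFormula.

(** * Power series *)

Section PowerSeries.
Variable R : realType.
Implicit Types (a b : nat -> R[i]) (f g : R[i] -> R[i]) (x y z h : R[i]).

Lemma geom_sum_le (q : R) m n : 0 <= q < 1 -> \sum_(m <= k < n) q ^+ k <= q ^+ m / (1 - q).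
Proof.
move=> /andP[q0 q1]; have q2 : 0 < 1 - q by rewrite subr_gt0.
have [mn|nm] := leqP m n; last first.
  by rewrite big_geq ?(ltnW nm) // divr_ge0 ?exprn_ge0 ?(ltW q2).
rewrite ler_pdivlMr //.
have -> : (\sum_(m <= k < n) q ^+ k) * (1 - q) = q ^+ m - q ^+ n.
  rewrite -[RHS]opprB -(telescope_sumr (fun k => q ^+ k)) // -sumrN mulr_suml.
  by apply: eq_bigr => k _; rewrite exprS; ring.
by rewrite gerBl exprn_ge0.
Qed.

(** Summing the recursion gives S <= q S + A. It bounds both the sum of k q^(k-1) and the
    second-order remainders of a power series. *)
Lemma sum_rec_le (q A : R) (b e : nat -> R) n : 0 <= q < 1 -> (forall k, 0 <= b k) ->
  b 0%N = 0 -> (forall k, b k.+1 <= q * b k + e k) ->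
  (forall n, \sum_(0 <= k < n) e k <= A) -> \sum_(0 <= k < n) b k <= A / (1 - q).
Proof.
move=> /andP[q0 q1] bp b0 bS eA; have q2 : 0 < 1 - q by rewrite subr_gt0.
have A0 : 0 <= A by apply: le_trans (eA 0%N); rewrite big_geq.
case: n => [|n]; first by rewrite big_geq // divr_ge0 // ltW.
rewrite ler_pdivlMr //; set S := \sum_(_ <= _ < _) _.
have : S <= q * S + A.
  rewrite {1}/S big_nat_recl // b0 add0r.
  apply: le_trans (ler_sum _ (fun k _ => bS k)) _.
  rewrite big_split /= lerD // -mulr_sumr ler_wpM2l // /S big_nat_recr //= lerDl.
  exact: bp.
lra.
Qed.

Lemma sum_deriv_geom_le (q : R) n : 0 <= q < 1 ->
  \sum_(0 <= k < n) k%:R * q ^+ k.-1 <= (1 - q)^-1 / (1 - q).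
Proof.
move=> q01; have /andP[q0 q1] := q01.
apply: (@sum_rec_le q _ _ (fun k => q ^+ k)) => //.
- by move=> k; rewrite mulr_ge0 ?exprn_ge0.
- by rewrite mul0r.
- case=> [|k] /=; first by rewrite mul0r mulr0 expr0 add0r mulr1.
  by rewrite exprS -!natr1; lra.
- by move=> m; apply: le_trans (geom_sum_le 0 m q01) _; rewrite expr0 mul1r.
Qed.

Lemma deriv_geom_bnd (q : R) k : 0 <= q < 1 -> k.+1%:R * q ^+ k <= (1 - q)^-1 / (1 - q).
Proof.
move=> q01; apply: le_trans (sum_deriv_geom_le k.+2 q01).
rewrite big_nat_recr //= lerDr sumr_ge0 // => j _.
by case/andP: q01 => q0 _; rewrite mulr_ge0 ?exprn_ge0.
Qed.

Definition psum a z n := \sum_(0 <= k < n) a k * z ^+ k.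
(** Always defined through [ulim]; inside the radius of convergence it is the ordinary sum, by
    [psum_cvg]. *)
Definition pser a z := ulim (psum a z).
(** Abel's description of the radius of convergence, by bounded terms instead of a limit
    superior. *)
Definition radius_ge (rho : R) a :=
  forall s : R, 0 <= s < rho -> exists B, forall k, nrm (a k) * s ^+ k <= B.
Definition dcoef a k : R[i] := k.+1%:R * a k.+1.

Lemma between (s t : R) : s < t -> exists2 u, s < u & u < t.
Proof. by move=> st; exists ((s + t) / 2); lra. Qed.

(** For s < u < rho the factor (k + 1)(s/u)^k stays bounded, so passing from u to s absorbs the
    factor produced by differentiation. *)
Lemma radius_dcoef rho a : radius_ge rho a -> radius_ge rho (dcoef a).
Proof.
move=> ra s /andP[s0 /between[u su ur]].
have u0 : 0 < u := le_lt_trans s0 su.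
have [B hB] : exists B, forall k, nrm (a k) * u ^+ k <= B by apply: ra; rewrite (ltW u0).
have q01 : 0 <= s / u < 1 by rewrite divr_ge0 ?(ltW u0) //= ltr_pdivrMr // mul1r.
exists ((1 - s / u)^-1 / (1 - s / u) * (B / u)) => k.
have B0 := hB k.+1; have n0 := nrm_ge0 (a k.+1).
rewrite /dcoef nrmM nrm_nat.
have -> : k.+1%:R * nrm (a k.+1) * s ^+ k =
    (k.+1%:R * (s / u) ^+ k) * (nrm (a k.+1) * u ^+ k.+1 / u).
  rewrite exprMn exprS exprVn; field.
  by rewrite gt_eqF //= expf_neq0 // gt_eqF.
apply: ler_pM.
- by case/andP: q01 => q0 _; rewrite mulr_ge0 ?exprn_ge0.
- by rewrite divr_ge0 ?(ltW u0) // mulr_ge0 // exprn_ge0 // ltW.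
- exact: deriv_geom_bnd.
- by rewrite ler_pM2r ?invr_gt0.
Qed.

Lemma psum_tail a z (s B : R) m n : 0 < s -> nrm z < s ->
  (forall k, nrm (a k) * s ^+ k <= B) -> (m <= n)%N ->
  nrm (psum a z n - psum a z m) <= B * ((nrm z / s) ^+ m / (1 - nrm z / s)).
Proof.
move=> s0 zs aB mn; set q := nrm z / s.
have q01 : 0 <= q < 1 by rewrite divr_ge0 ?nrm_ge0 ?(ltW s0) //= ltr_pdivrMr // mul1r.
have B0 : 0 <= B by apply: le_trans (aB 0%N); rewrite mulr_ge0 ?nrm_ge0 // exprn_ge0 // ltW.
have -> : psum a z n - psum a z m = \sum_(m <= k < n) a k * z ^+ k.
  by rewrite /psum (big_cat_nat (leq0n m) mn) /= addrAC subrr add0r.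
apply: le_trans (nrm_sum _ _ _) _.
apply: (@le_trans _ _ (\sum_(m <= k < n) B * q ^+ k)).
  apply: ler_sum => k _; rewrite nrmM nrmX /q exprMn exprVn.
  have sk : 0 < s ^+ k by rewrite exprn_gt0.
  rewrite mulrA ler_pdivlMr // mulrAC ler_wpM2r // exprn_ge0 // nrm_ge0 //.
by rewrite -mulr_sumr ler_wpM2l // geom_sum_le.
Qed.

Lemma psum_cvg a z rho : radius_ge rho a -> nrm z < rho ->
  forall eps : R, 0 < eps -> exists n0, forall n, (n0 <= n)%N ->
    nrm (psum a z n - pser a z) <= eps.
Proof.
move=> ra /between[s zs sr] eps eps0; have s0 : 0 < s := le_lt_trans (nrm_ge0 z) zs.
have [B hB] : exists B, forall k, nrm (a k) * s ^+ k <= B by apply: ra; rewrite (ltW s0).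
have tail := psum_tail s0 zs hB.
set q := nrm z / s in tail.
have q01 : 0 <= q < 1 by rewrite divr_ge0 ?nrm_ge0 ?(ltW s0) //= ltr_pdivrMr // mul1r.
have /andP[q0 q1] := q01; have q2 : 0 < 1 - q by rewrite subr_gt0.
have B0 : 0 <= B by apply: le_trans (hB 0%N); rewrite mulr_ge0 ?nrm_ge0 // exprn_ge0 // ltW.
have bd n : nrm (psum a z n) <= B * (q ^+ 0 / (1 - q)).
  have -> : psum a z n = psum a z n - psum a z 0 by rewrite /psum [X in _ - X]big_geq // subr0.
  exact: tail.
have cv := ulimP bd; rewrite -/(pser a z) in cv.
have B1 : 0 < B + 1 by rewrite ltr_wpDl.
have [K qK] := geom_lt q01 (divr_gt0 (mulr_gt0 eps0 q2) B1).
exists K => n Kn; rewrite nrmBC.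
have h := ucvgB cv (ucvg_cst (psum a z n)); apply: (ucvg_le h).
apply: filterS (nat_ultra_ge n) => m /= nm; apply: le_trans (tail _ _ nm) _.
have qn : q ^+ n <= q ^+ K.
  by rewrite -(subnK Kn) exprD ler_piMl ?exprn_ge0 // exprn_ile1 // ltW.
move: qK; rewrite ltr_pdivlMr // mulrA ler_pdivrMr // => qK.
have qn0 : 0 <= q ^+ n by rewrite exprn_ge0.
nra.
Qed.

Lemma psum_ucvg a z rho : radius_ge rho a -> nrm z < rho -> ucvg (psum a z) (pser a z).
Proof. move=> ra zr; apply: ucvg_eventually; exact: psum_cvg zr. Qed.

Lemma psum_ucvgS a z rho : radius_ge rho a -> nrm z < rho ->
  ucvg (fun n => psum a z n.+1) (pser a z).
Proof.
move=> ra zr; apply: ucvg_eventually => eps eps0.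
have [n0 Hn] := psum_cvg ra zr eps0; exists n0 => n n0n.
by apply: Hn; exact: leqW.
Qed.

Lemma pser_eq a z l (C q : R) : 0 <= q < 1 -> (forall n, nrm (l - psum a z n) <= C * q ^+ n) ->
  pser a z = l.
Proof.
move=> q01 H; apply: ulimE; apply: ucvg_eventually => eps eps0.
have /andP[q0 q1] := q01.
have C0 : 0 <= C by have := le_trans (nrm_ge0 _) (H 0%N); rewrite expr0 mulr1.
have C1 : 0 < C + 1 by rewrite ltr_wpDl.
have [K qK] := geom_lt q01 (divr_gt0 eps0 C1).
exists K => n Kn; rewrite nrmBC; apply: le_trans (H n) _.
have qn : q ^+ n <= q ^+ K.
  by rewrite -(subnK Kn) exprD ler_piMl ?exprn_ge0 // exprn_ile1 // ltW.
have qn0 : 0 <= q ^+ n by rewrite exprn_ge0.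
move: qK; rewrite ltr_pdivlMr // => qK; nra.
Qed.

Lemma psum0 a n : psum a 0 n.+1 = a 0%N.
Proof.
rewrite /psum big_nat_recl // expr0 mulr1 big1 ?addr0 // => k _.
by rewrite exprS mul0r mulr0.
Qed.

Lemma pser0 a : pser a 0 = a 0%N.
Proof.
apply: ulimE; apply: ucvg_eventually => eps eps0; exists 1%N; case=> // n _.
by rewrite psum0 subrr nrm0 ltW.
Qed.

(** The remainders d_k = (z + h)^k - z^k - k z^(k-1) h satisfy d_(k+1) = (z + h) d_k + k z^(k-1)
    h^2. Scaled by s^k they fall under [sum_rec_le], and the bound is quadratic in h, uniformly in
    n. *)
Lemma psum_deriv_le a z h (s1 s B : R) n : 0 < s1 < s -> nrm z <= s1 -> nrm (z + h) <= s1 ->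
  (forall k, nrm (a k) * s ^+ k <= B) ->
  nrm (psum a (z + h) n.+1 - psum a z n.+1 - psum (dcoef a) z n * h) <=
  B / s ^+ 2 / (1 - s1 / s) ^+ 3 * nrm h ^+ 2.
Proof.
move=> /andP[s10 s1s] zs zhs aB; have s0 : 0 < s := lt_trans s10 s1s.
set q := s1 / s.
have q01 : 0 <= q < 1 by rewrite divr_ge0 ?(ltW s0) ?(ltW s10) //= ltr_pdivrMr // mul1r.
have /andP[q0 q1] := q01; have q2 : 0 < 1 - q by rewrite subr_gt0.
have B0 : 0 <= B by apply: le_trans (aB 0%N); rewrite mulr_ge0 ?nrm_ge0 // exprn_ge0 // ltW.
pose d k := (z + h) ^+ k - z ^+ k - k%:R * z ^+ k.-1 * h.
have dS k : d k.+1 = (z + h) * d k + k%:R * z ^+ k.-1 * h ^+ 2.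
  rewrite /d /=; case: k => [|k] /=; first by rewrite !expr0 expr1; ring.
  by rewrite !exprS -!natr1; ring.
pose b k := nrm (d k) / s ^+ k.
pose e k := (nrm h ^+ 2 / s ^+ 2) * (k%:R * q ^+ k.-1).
have sumb : \sum_(0 <= k < n.+1) b k <= (nrm h ^+ 2 / s ^+ 2) * ((1 - q)^-1 / (1 - q)) / (1 - q).
  apply: (@sum_rec_le q _ b e) => //.
  - by move=> k; rewrite divr_ge0 ?nrm_ge0 // exprn_ge0 // ltW.
  - by rewrite /b /d !expr0 subrr sub0r mul0r mul0r oppr0 nrm0 mul0r.
  - move=> k; have sk : 0 < s ^+ k.+1 by rewrite exprn_gt0.
    rewrite /b /e ler_pdivrMr // dS; apply: le_trans (nrmD _ _) _.
    rewrite !nrmM nrm_nat !nrmX -expr2.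
    have -> : (q * (nrm (d k) / s ^+ k) + nrm h ^+ 2 / s ^+ 2 * (k%:R * q ^+ k.-1)) * s ^+ k.+1 =
       s1 * nrm (d k) + k%:R * s1 ^+ k.-1 * nrm h ^+ 2.
      rewrite /q; case: k {sk dS} => [|k] /=.
        rewrite expr0 !mul0r mulr0 !addr0 expr1; field; exact: lt0r_neq0.
      rewrite exprMn exprVn !exprS; field.
      by rewrite expf_neq0 ?lt0r_neq0.
    rewrite lerD //; first by rewrite ler_wpM2r ?nrm_ge0.
    rewrite ler_wpM2r ?exprn_ge0 ?nrm_ge0 // ler_wpM2l //.
    by rewrite lerXn2r ?nnegrE ?nrm_ge0 ?(ltW s10).
  - move=> m; rewrite -mulr_sumr ler_wpM2l ?sum_deriv_geom_le //.
    by rewrite divr_ge0 ?exprn_ge0 ?nrm_ge0 ?(ltW s0).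
have -> : psum a (z + h) n.+1 - psum a z n.+1 - psum (dcoef a) z n * h =
    \sum_(0 <= k < n.+1) a k * d k.
  have d00 : d 0%N = 0 by rewrite /d !expr0 subrr sub0r mul0r mul0r oppr0.
  rewrite [RHS]big_nat_recl // d00 mulr0 add0r /psum -sumrB big_nat_recl //.
  rewrite !expr0 subrr add0r mulr_suml -sumrB.
  apply: eq_bigr => k _; rewrite /d /dcoef /=; ring.
apply: le_trans (nrm_sum _ _ _) _.
apply: (@le_trans _ _ (\sum_(0 <= k < n.+1) B * b k)).
  apply: ler_sum => k _; have sk : 0 < s ^+ k by rewrite exprn_gt0.
  rewrite nrmM /b mulrA ler_pdivlMr // mulrAC ler_wpM2r ?nrm_ge0 //.
rewrite -mulr_sumr; apply: le_trans (ler_wpM2l B0 sumb) _.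
rewrite le_eqVlt; apply/orP; left; apply/eqP; field.
by rewrite !gt_eqF.
Qed.

Lemma pser_deriv a z rho : radius_ge rho a -> nrm z < rho ->
  deriv_at (pser a) z (pser (dcoef a) z).
Proof.
move=> ra zr eps eps0; have [s1 zs1 s1r] := between zr; have [s s1s sr] := between s1r.
have s10 : 0 < s1 := le_lt_trans (nrm_ge0 z) zs1; have s0 : 0 < s := lt_trans s10 s1s.
have [B hB] : exists B, forall k, nrm (a k) * s ^+ k <= B by apply: ra; rewrite (ltW s0).
have B0 : 0 <= B by apply: le_trans (hB 0%N); rewrite mulr_ge0 ?nrm_ge0 // exprn_ge0 // ltW.
set C := B / s ^+ 2 / (1 - s1 / s) ^+ 3.
have C0 : 0 <= C.
  rewrite !divr_ge0 ?exprn_ge0 ?(ltW s0) // subr_ge0 ler_pdivrMr // mul1r ltW //.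
have C1 : 0 < C + 1 by rewrite ltr_wpDl.
exists (Num.min (s1 - nrm z) (eps / (C + 1))) => [|h].
  by rewrite lt_min subr_gt0 zs1 divr_gt0.
rewrite lt_min => /andP[hz]; rewrite ltr_pdivlMr // => hC.
have zh : nrm (z + h) <= s1 by apply: le_trans (nrmD _ _) _; lra.
have K := ucvgB (ucvgB (psum_ucvgS ra (le_lt_trans zh s1r)) (psum_ucvgS ra zr))
  (ucvgZ h (psum_ucvg (radius_dcoef ra) zr)).
rewrite (mulrC _ h).
apply: (@le_trans _ _ (C * nrm h ^+ 2)).
  apply: (ucvg_le K); apply: filterS filterT => n _ /=; rewrite (mulrC h).
  by apply: psum_deriv_le => //; rewrite ?s10 // ltW.
by have := nrm_ge0 h; nra.
Qed.

Lemma analytic_deriv f a z rho : radius_ge rho a -> nrm z < rho ->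
  (forall z, nrm z < rho -> f z = pser a z) -> deriv_at f z (pser (dcoef a) z).
Proof.
move=> ra zr fa; apply: (@deriv_at_local _ (pser a) _ _ _ (rho - nrm z)).
- by rewrite subr_gt0.
- move=> h hr; rewrite fa //; apply: le_lt_trans (nrmD _ _) _; lra.
- exact: pser_deriv zr.
Qed.

(** The iterated derivative is unrolled from the inside: [dC f] is again a power series, with
    coefficients [dcoef a], so the induction generalizes over f and a. *)
Lemma analytic_coef f a rho n : 0 < rho -> radius_ge rho a ->
  (forall z, nrm z < rho -> f z = pser a z) -> coef f n = a n.
Proof.
move=> rho0 ra fa; rewrite /coef.
suff -> : derive1n n (f : R[i]^o -> R[i]^o) 0 = n`!%:R * a n.
  by rewrite mulrC mulKf // pnatr_eq0 -lt0n fact_gt0.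
elim: n f a ra fa => [|n IH] f a ra fa.
  by rewrite fact0 mul1r /derive1n /= fa ?nrm0 // pser0.
rewrite /derive1n iterSr -/(derive1n n _).
rewrite (IH (dC f) (dcoef a)); first by rewrite /dcoef factS natrM; ring.
  exact: radius_dcoef.
by move=> z zr; have [] := deriv_at_derive1 (analytic_deriv ra zr fa).
Qed.

(** On each circle Cauchy's formula and the expansion of the kernel give a power series whose
    coefficients are means. By [analytic_coef] they equal [coef f], so they do not depend on r and
    the expansions agree on the whole disc. *)
Lemma C1_analytic f f' : C1 f f' -> [/\ radius_ge 1 (coef f),
  forall z, nrm z < 1 -> f z = pser (coef f) z &
  forall r k, 0 < r < 1 -> mean r (fun e => f e * e^-1 ^+ k) = coef f k].
Proof.
move=> fC.
have main r : 0 < r < 1 -> let a k := mean r (fun e => f e * e^-1 ^+ k) in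
    radius_ge r a /\ forall z, nrm z < r -> f z = pser a z.
  move=> r01 a; have /andP[r0 r1] := r01; have r0' := ltW r0.
  have [B hB] := cbnd_C1 fC r1.
  have aB k : nrm (a k) * r ^+ k <= B.
    have rk : 0 < r ^+ k by rewrite exprn_gt0.
    rewrite -ler_pdivlMr //; apply: mean_le => // e er.
    by rewrite nrmM nrmX nrmV er exprVn ler_pM2r ?invr_gt0 // hB.
  split=> [s /andP[s0 sr]|z zr].
    exists B => k; apply: le_trans (aB k); rewrite ler_wpM2l ?nrm_ge0 //.
    by rewrite lerXn2r ?nnegrE // ltW.
  apply/esym/(@pser_eq _ _ _ (B * (r / (r - nrm z))) (nrm z / r)) => [|n].
    by rewrite divr_ge0 ?nrm_ge0 //= ltr_pdivrMr // mul1r.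
  rewrite -(cauchy_formula fC r01 zr); exact: mean_kernel_expand.
have cE r k : 0 < r < 1 -> mean r (fun e => f e * e^-1 ^+ k) = coef f k.
  move=> r01; have /andP[r0 _] := r01; have [h1 h2] := main r r01.
  by rewrite (analytic_coef k r0 h1 h2).
have cE' r : 0 < r < 1 -> (fun k => mean r (fun e => f e * e^-1 ^+ k)) = coef f.
  by move=> r01; apply/funext => k; exact: cE.
split=> // [s /andP[s0 /between[r sr r1]]|z /between[r zr r1]].
  have r01 : 0 < r < 1 by rewrite r1 (le_lt_trans s0 sr).
  by have [+ _] := main r r01; rewrite cE' //; apply; rewrite s0.
have r01 : 0 < r < 1 by rewrite r1 (le_lt_trans (nrm_ge0 z) zr).
by have [_] := main r r01; rewrite cE' //; apply.
Qed.

Lemma analytic_C1 f a : radius_ge 1 a -> (forall z, nrm z < 1 -> f z = pser a z) ->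
  C1 f (pser (dcoef a)).
Proof.
move=> ra fa; split=> z z1; first exact: analytic_deriv z1 fa.
apply: deriv_at_cont (pser_deriv (radius_dcoef ra) z1).
Qed.

Lemma C1_deriv f f' : C1 f f' -> exists f'', C1 f' f''.
Proof.
move=> fC; have [ra fa _] := C1_analytic fC.
exists (pser (dcoef (dcoef (coef f)))); apply: analytic_C1 (radius_dcoef ra) _ => z z1.
exact: deriv_at_unique (fC.1 _ z1) (analytic_deriv ra z1 fa).
Qed.

End PowerSeries.

(** * The function sqrt(1 + tanh z) *)

Section TanhSqrt.
Variable R : realType.
Implicit Types (f g s v w : R[i] -> R[i]) (x y z h : R[i]).

Definition expcoef (k : nat) : R[i] := k`!%:R^-1.

(** Radius 2 follows from 2^k <= 2 k!, and it suffices: [expCDN] evaluates the exponential at sums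
    of two points of the unit disc. *)
Lemma expcoef_radius : radius_ge 2 expcoef.
Proof.
move=> s /andP[s0 s2]; exists 2 => k; rewrite nrmV nrm_nat.
apply: (@le_trans _ _ (k`!%:R^-1 * 2 ^+ k)).
  by rewrite ler_wpM2l ?invr_ge0 // lerXn2r ?nnegrE // ltW.
rewrite ler_pdivrMl ?ltr0n ?fact_gt0 // -natrX -natrM ler_nat.
elim: k => // -[|k] // IH.
by rewrite expnS factS -mulnA leq_mul.
Qed.

Lemma dcoef_expcoef : dcoef expcoef = expcoef.
Proof.
apply/funext => k; by rewrite /dcoef /expcoef factS natrM invfM mulrA mulfV ?mul1r //.
Qed.

Lemma expCE z : nrm z < 2 -> expC z = pser expcoef z.
Proof.
move=> z2.
suff X : ((series (fun n => z ^+ n / n`!%:R : R[i]^o) : nat -> R[i]^o) @ \oo -->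
    (pser expcoef z : R[i]^o))%classic.
  have Y := cvg_lim (@norm_hausdorff _ _) X; rewrite /expC; exact: Y.
apply/cvgrPdist_le => e /Cpos[r r0 ->].
have [n0 Hn] := psum_cvg expcoef_radius z2 r0.
exists n0 => // n /= /Hn; rewrite nrmBC normC_nrm lecR.
suff -> : series (fun n => z ^+ n / n`!%:R : R[i]^o) n = psum expcoef z n by [].
by apply: eq_bigr => k _; rewrite mulrC.
Qed.

Lemma expC_deriv z : nrm z < 2 -> deriv_at (@expC R) z (expC z).
Proof.
move=> z2; rewrite [X in deriv_at _ _ X]expCE // -dcoef_expcoef.
by apply: (analytic_deriv expcoef_radius z2) => x; exact: expCE.
Qed.

Lemma expC0 : expC (0 : R[i]) = 1.
Proof. by rewrite expCE ?nrm0 // pser0 /expcoef fact0 invr1. Qed.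

Lemma expC_derivN z : nrm z < 2 -> deriv_at (fun x => expC (- x)) z (- expC (- z)).
Proof.
move=> z2; have := deriv_at_comp (deriv_atN (deriv_at_id z)) (expC_deriv _).
by rewrite nrmN mulrN1; apply.
Qed.

(** The function t -> exp(x + t) exp(-t) has derivative 0, hence is constant by [mvt_ineq]. *)
Lemma expCDN x z : nrm x < 1 -> nrm z < 1 -> expC (x + z) * expC (- z) = expC x.
Proof.
move=> x1 z1; move: (expC_deriv) (expC_derivN) expC0; move: (@expC R) => E dE dEN E0.
pose G t := E (x + t) * E (- t).
have dG t : nrm t < 1 -> deriv_at G t ((fun=> 0) t).
  move=> t1.
  have t2 : nrm t < 2 by lra.
  have xt2 : nrm (x + t) < 2 by apply: le_lt_trans (nrmD _ _) _; lra.
  have d1 := deriv_at_comp (deriv_atD (deriv_at_cst x t) (deriv_at_id t)) (dE _ xt2).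
  by apply: deriv_at_eq (deriv_atM d1 (dEN _ t2)) _; ring.
have z0 : nrm (0 : R[i]) < 1 by rewrite nrm0.
have := @mvt_ineq _ 1 0 G (fun=> 0) 0 0 z dG z0 z1.
rewrite subrr nrm0 lexx subr0 !mul0r subr0 => /(_ (fun _ _ => isT)).
rewrite le_eqVlt ltNge nrm_ge0 orbF nrm_eq0 subr_eq0 => /eqP.
by rewrite /G addr0 oppr0 E0 mulr1.
Qed.

Lemma expC_double y : nrm y < 1 -> expC (y + y) = expC y ^+ 2.
Proof.
move=> y1; have E1 := expCDN y1 y1; have o1 : nrm (0 : R[i]) < 1 by rewrite nrm0 ltr01.
have E2 := expCDN o1 y1; move: E1 E2 expC0; move: (@expC R) => E E1 E2 E0.
by rewrite add0r E0 in E2; rewrite expr2 -{2}E1 mulrCA E2 mulr1.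
Qed.

(** Since (k + 1)! >= 2^k, the series of exp y - 1 is dominated by the sum of (1/2)(1/4)^k, which is
    2/3. *)
Lemma expC_near1 y : nrm y <= 1 / 2 -> nrm (expC y - 1) <= 2 / 3.
Proof.
move=> y2; have y1 : nrm y < 2 by lra.
rewrite expCE //.
have K := ucvgB (psum_ucvgS expcoef_radius y1) (ucvg_cst 1).
apply: (ucvg_le K); apply: filterS filterT => n _ /=.
rewrite /psum big_nat_recl // expr0 mulr1 [expcoef 0]invr1 addrAC subrr add0r.
apply: le_trans (nrm_sum _ _ _) _.
have q01 : 0 <= (1 / 4 : R) < 1 by lra.
have := geom_sum_le 0 n q01; rewrite expr0.
have -> : 1 / (1 - 1 / 4) = 4 / 3 :> R by field.
move=> H; apply: (@le_trans _ _ (\sum_(0 <= k < n) (1 / 2) * (1 / 4) ^+ k)).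
  apply: ler_sum => k _; rewrite nrmM nrmX nrmV nrm_nat.
  have f1 : (2 ^+ k : R) <= (k.+1)`!%:R.
    rewrite -natrX ler_nat; elim: k => // k IH.
    by rewrite expnS factS leq_mul.
  have f2 : (k.+1)`!%:R^-1 <= (1 / 2) ^+ k :> R.
    by rewrite div1r exprVn lef_pV2 // posrE ?exprn_gt0 // ltr0n fact_gt0.
  have y3 : nrm y ^+ k.+1 <= (1 / 2) ^+ k.+1 by rewrite lerXn2r ?nnegrE ?nrm_ge0.
  have -> : (1 / 2) * (1 / 4) ^+ k = (1 / 2) ^+ k * (1 / 2) ^+ k.+1 :> R.
    have -> : (1 / 4 : R) = (1 / 2) * (1 / 2) by field.
    by rewrite exprMn exprS; ring.
  by apply: ler_pM; rewrite ?invr_ge0 ?exprn_ge0 ?nrm_ge0.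
rewrite -mulr_sumr; lra.
Qed.

(* exp w is the square of a number at distance less than 1/sqrt 2 from 1. *)
Lemma Re_expC_gt0 z : nrm z < 1 -> 0 < complex.Re (expC z).
Proof.
move=> z1; set y := ((1 / 2)%:C)%C * z.
have y2 : nrm y <= 1 / 2 by rewrite nrmM nrmR ger0_norm; have := nrm_ge0 z; lra.
have -> : z = y + y by rewrite -mulrDl -rmorphD -splitr rmorph1 mul1r.
rewrite expC_double ?expr2; last by lra.
have := expC_near1 y2; have := nrm_ge0 (expC y - 1).
have := sqr_nrm (expC y - 1); move: (nrm (expC y - 1)) => n.
case: (expC y) => a b /= H h1 h2.
have : n ^+ 2 <= (2 / 3) ^+ 2 by rewrite lerXn2r ?nnegrE.
(* From (a - 1)^2 + b^2 <= 4/9 follows a^2 - b^2 >= 2 (a - 1/2)^2 + 1/2 - 4/9 > 0. *)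
have := sqr_ge0 (a - 1 / 2); rewrite H; lra.
Qed.

Lemma Re_cosh_gt0 z : nrm z < 1 -> 0 < complex.Re (expC z + expC (- z)).
Proof. by move=> z1; rewrite ReD addr_gt0 // Re_expC_gt0 // nrmN. Qed.

Lemma Re_neq0 z : 0 < complex.Re z -> z != 0.
Proof. by move=> h; apply: contraTneq h => ->; rewrite ltxx. Qed.

Lemma onePtanhC z : nrm z < 1 -> 1 + tanhC z = 2 * expC z / (expC z + expC (- z)).
Proof.
move=> /Re_cosh_gt0/Re_neq0; rewrite /tanhC.
by move: (expC z) (expC (- z)) => u v uv0; field.
Qed.

Lemma oneMtanhC_neq0 z : nrm z < 1 -> 1 - tanhC z != 0.
Proof.
move=> z1; have c0 := Re_neq0 (Re_cosh_gt0 z1).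
have -> : 1 - tanhC z = 2 * expC (- z) / (expC z + expC (- z)).
  by rewrite /tanhC; move: (expC z) (expC (- z)) c0 => u v c0; field.
by rewrite !mulf_neq0 ?invr_neq0 ?pnatr_eq0 // Re_neq0 // Re_expC_gt0 ?nrmN.
Qed.

Lemma tanh_quotient_deriv (E : R[i] -> R[i]) z : deriv_at E z (E z) ->
  deriv_at (fun x => E (- x)) z (- E (- z)) -> E z + E (- z) != 0 ->
  let T x := (E x - E (- x)) / (E x + E (- x)) in deriv_at T z (1 - T z ^+ 2).
Proof.
move=> dp dm c0 T.
have H := deriv_atM (deriv_atB dp dm) (@deriv_atV _ (fun x => E x + E (- x)) z _ c0 (deriv_atD dp dm)).
apply: (@deriv_at_eq _ T _ _ _ H).
rewrite {H}/T; by move: (E z) (E (- z)) c0 {dp dm} => u v c0; field.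
Qed.

Lemma tanhC_deriv z : nrm z < 1 -> deriv_at (@tanhC R) z (1 - tanhC z ^+ 2).
Proof.
move=> z1; have z2 : nrm z < 2 by lra.
exact (tanh_quotient_deriv (expC_deriv z2) (expC_derivN z2) (Re_neq0 (Re_cosh_gt0 z1))).
Qed.

Lemma frakB_sqr z : frakB z ^+ 2 = 1 + tanhC z.
Proof. exact: sqr_sqrtc. Qed.

(** The principal root has real part >= 0. Were it 0, B^2 would be a real -b^2, and 2 exp z = -b^2
    (exp z + exp(-z)) would equate a positive real part with a nonpositive one. *)
Lemma Re_frakB_gt0 z : nrm z < 1 -> 0 < complex.Re (frakB z).
Proof.
move=> z1; rewrite lt_neqAle Re_sqrtc_ge0 andbT; apply/negP => /eqP s0.
have c0 := Re_neq0 (Re_cosh_gt0 z1).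
have := onePtanhC z1; rewrite -frakB_sqr => /(congr1 (fun t => t * (expC z + expC (- z)))).
rewrite divfK //.
have := Re_expC_gt0 z1; have := Re_cosh_gt0 z1; move: s0.
move: (expC z) (expC (- z)) (frakB z) {c0} => E Em [a b] /= <-.
have -> : (0 +i* b)%C ^+ 2 = ((- b ^+ 2)%:C)%C :> R[i].
  by rewrite expr2; simpc; rewrite expr2.
move=> h1 h2 /(congr1 (@complex.Re R)); rewrite ReZ.
have -> : (2 : R[i]) = ((2 : R)%:C)%C by rewrite rmorph_nat.
rewrite ReZ; have := sqr_ge0 b; nra.
Qed.

Lemma frakB_neq0 z : nrm z < 1 -> frakB z != 0.
Proof. by move=> z1; apply/Re_neq0/Re_frakB_gt0. Qed.

(** Here 2 - B^2 = 1 - tanh. With [frakB_neq0] this permits the division that recovers w' from f''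
    in [frakB_subord_C1]. *)
Lemma twoMfrakB_neq0 z : nrm z < 1 -> 2 - frakB z ^+ 2 != 0.
Proof.
by move=> z1; rewrite frakB_sqr opprD addrA -(natrB _ (isT : (1 <= 2)%N)) oneMtanhC_neq0.
Qed.

Lemma frakB0 : frakB (0 : R[i]) = 1.
Proof. by rewrite /frakB /tanhC oppr0 subrr mul0r addr0 sqrtc1. Qed.

(* The difference quotient of a square root s of v is that of v divided by
   s(z + h) + s(z), which does not vanish since both terms lie in a half-plane. *)
Lemma deriv_at_sqrt s v z d (r : R) : 0 < r ->
  (forall h, nrm h < r -> s (z + h) ^+ 2 = v (z + h)) ->
  (forall h, nrm h < r -> 0 < complex.Re (s (z + h))) ->
  deriv_at v z d -> deriv_at s z (d / (2 * s z)).
Proof.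
move=> r0 sv sp dv.
have svz : s z ^+ 2 = v z by have := sv 0; rewrite nrm0 addr0 => /(_ r0).
have spz : 0 < complex.Re (s z) by have := sp 0; rewrite nrm0 addr0 => /(_ r0).
have sumn0 h : nrm h < r -> s (z + h) + s z != 0.
  by move=> hr; apply: Re_neq0; rewrite ReD addr_gt0 ?sp.
have diff h : nrm h < r -> s (z + h) - s z = (v (z + h) - v z) / (s (z + h) + s z).
  move=> hr; rewrite -sv // -svz; field; exact: sumn0.
have sc : cont_at s z.
  move=> eps eps0; have [del del0 Hd] := deriv_at_cont dv (mulr_gt0 eps0 spz).
  exists (Num.min r del) => [|h]; first by rewrite lt_min r0.
  rewrite lt_min => /andP[hr /Hd Hv]; rewrite diff // nrmM nrmV.
  rewrite ler_pdivrMr ?nrm_gt0 ?sumn0 //; apply: le_trans Hv _.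
  rewrite ler_pM2l //; apply: le_trans (le_trans (ler_norm _) (Re_le_nrm _)).
  by rewrite ReD lerDr ltW // sp.
have [q [qc qz qE]] := deriv_at_quotE dv.
have -> : d / (2 * s z) = q z * (s z + s z)^-1 by rewrite qz -mulr2n mulr_natl.
apply: (@deriv_at_quot _ s z (fun x => q x * (s x + s z)^-1) r r0).
  apply: cont_atM => //; apply: cont_atV; first by have := sumn0 0; rewrite nrm0 addr0 => ->.
  by apply: cont_atD => //; exact: deriv_at_cont (deriv_at_cst _ _).
by move=> h hr; rewrite diff // qE; ring.
Qed.

(** Substituting tanh = B^2 - 1 turns 1 - tanh^2 into B^2 (2 - B^2), and one factor B cancels
    against the 2 B of the square root. *)
Lemma frakB_comp_deriv w z d : (forall x, nrm x < 1 -> nrm (w x) < 1) -> nrm z < 1 ->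
  deriv_at w z d ->
  deriv_at (fun x => frakB (w x)) z (frakB (w z) * (2 - frakB (w z) ^+ 2) * d / 2).
Proof.
move=> w1 z1 dw; have r0 : 0 < 1 - nrm z by rewrite subr_gt0.
have D h : nrm h < 1 - nrm z -> nrm (z + h) < 1.
  by move=> hr; apply: le_lt_trans (nrmD _ _) _; lra.
have dv := deriv_atD (deriv_at_cst 1 z) (deriv_at_comp dw (tanhC_deriv (w1 _ z1))).
have b0 := frakB_neq0 (w1 _ z1).
apply: deriv_at_eq (deriv_at_sqrt r0 _ _ dv) _.
- by move=> h _; rewrite frakB_sqr.
- by move=> h /D/w1; exact: Re_frakB_gt0.
have E : tanhC (w z) = frakB (w z) ^+ 2 - 1 by rewrite frakB_sqr addrC addKr.
by rewrite E; field.
Qed.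

End TanhSqrt.

(** * Schur's inequality *)

Section SchwarzCoefficients.
Variable R : realType.
Implicit Types (w : R[i] -> R[i]) (e : R[i]) (r : R).

Lemma mean_laurent r (a0 a1 a2 b1 b2 : R[i]) : 0 < r < 1 ->
  mean r (fun e => a0 + a1 * e ^+ 1 + a2 * e ^+ 2 + b1 * e^-1 ^+ 1 + b2 * e^-1 ^+ 2) = a0.
Proof.
move=> r01; have /andP[r0 r1] := r01; have r0' := ltW r0.
have P c n : cbnd r (fun e => c * e ^+ n) := cbndM (cbnd_cst r c) (cbndX n (cbnd_id r)).
have V c n : cbnd r (fun e => c * e^-1 ^+ n) := cbndM (cbnd_cst r c) (cbndX n (cbnd_inv r)).
rewrite !meanD //; try (by repeat apply: cbndD => //; exact: cbnd_cst).
rewrite mean_cst // !meanZ //; try exact: (cbndX _ (cbnd_id r)); try exact: (cbndX _ (cbnd_inv r)).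
by rewrite !mean_X_eq0 // !mean_V_eq0 // !mulr0 !addr0.
Qed.

(** The mean of w(e) e^-k is [coef w k]; the terms with nonnegative powers vanish by the mean value
    property, because w(0) = 0. *)
Lemma mean_w_laurent w w' r (a0 a1 b1 b2 b3 : R[i]) : C1 w w' -> w 0 = 0 -> 0 < r < 1 ->
  mean r (fun e => w e * (a0 + a1 * e ^+ 1 + b1 * e^-1 ^+ 1 + b2 * e^-1 ^+ 2 + b3 * e^-1 ^+ 3)) =
  b1 * coef w 1 + b2 * coef w 2 + b3 * coef w 3.
Proof.
move=> wC w0 r01; have /andP[r0 r1] := r01; have r0' := ltW r0.
have [_ _ wk] := C1_analytic wC.
have wb := cbnd_C1 wC r1.
have P n : cbnd r (fun e => w e * e ^+ n) := cbndM wb (cbndX n (cbnd_id r)).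
have V n : cbnd r (fun e => w e * e^-1 ^+ n) := cbndM wb (cbndX n (cbnd_inv r)).
have Z c f : cbnd r f -> cbnd r (fun e => c * f e) := cbndM (cbnd_cst r c).
rewrite (@eq_mean _ r _ (fun e => a0 * w e + a1 * (w e * e ^+ 1) + b1 * (w e * e^-1 ^+ 1) +
   b2 * (w e * e^-1 ^+ 2) + b3 * (w e * e^-1 ^+ 3))) //; last by move=> e _; ring.
rewrite !meanD //; try (by repeat apply: cbndD => //; auto); try (by auto).
rewrite !meanZ // !wk // (mean_value wC r01) w0.
have -> : mean r (fun e => w e * e ^+ 1) = 0.
  by rewrite (mean_value (C1M wC (C1X R 1)) r01) w0 mul0r.
by rewrite !mulr0 !add0r.
Qed.

(** For X = x0 + x1 (e/r) + x2 (e/r)^2 and Y = y1 (r/e) + y2 (r/e)^2 + y3 (r/e)^3, the bound |w| <=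
    1 gives 2 Re(w X Y) <= |X|^2 + |Y|^2 on the circle. The mean of the left side is the Toeplitz
    form with c_k replaced by r^k c_k, that of the right side is the sum of squares; then r tends to
    1. *)
Lemma toeplitz_ineq w w' (x0 x1 x2 y1 y2 y3 : R[i]) : C1 w w' -> w 0 = 0 ->
  (forall z, nrm z < 1 -> nrm (w z) <= 1) ->
  2 * complex.Re (y1 * (coef w 1 * x0) + y2 * (coef w 2 * x0 + coef w 1 * x1) +
    y3 * (coef w 3 * x0 + coef w 2 * x1 + coef w 1 * x2)) <=
  nrm x0 ^+ 2 + nrm x1 ^+ 2 + nrm x2 ^+ 2 + nrm y1 ^+ 2 + nrm y2 ^+ 2 + nrm y3 ^+ 2.
Proof.
move=> wC w0 w1.
set c1 := coef w 1; set c2 := coef w 2; set c3 := coef w 3.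
set S := (X in _ <= X).
pose A := complex.Re (c1 * (y1 * x0 + y2 * x1 + y3 * x2)).
pose B := complex.Re (c2 * (y2 * x0 + y3 * x1)).
pose D := complex.Re (c3 * (y3 * x0)).
have main r : 0 < r < 1 -> 2 * (r * A + r ^+ 2 * B + r ^+ 3 * D) <= S.
  move=> r01; have /andP[r0 r1] := r01; have r0' := ltW r0.
  pose rc := (r%:C)%C; have rc0 : rc != 0 by rewrite -nrm_gt0 nrmR ger0_norm.
  pose X e := x0 + x1 * (e / rc) + x2 * (e / rc) ^+ 2.
  pose Y e := y1 * (rc / e) + y2 * (rc / e) ^+ 2 + y3 * (rc / e) ^+ 3.
  have conj_e e : nrm e = r -> (e^*)%C = rc ^+ 2 / e.
    move=> er; have e0 := circle_neq0 r0 er.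
    by apply: (mulfI e0); rewrite mul_conj er rmorphXn mulrCA divff ?mulr1.
  have conj_rc : (rc^*)%C = rc := conjc_real r.
  have cX e : nrm e = r -> ((X e)^*)%C = (x0^*)%C + (x1^*)%C * (rc / e) + (x2^*)%C * (rc / e) ^+ 2.
    move=> er; have e0 := circle_neq0 r0 er.
    rewrite /X !(conjcD, conjcX, conjcM, conjcV) conj_rc !(conj_e e er); field.
    by rewrite rc0 e0.
  have cY e : nrm e = r -> ((Y e)^*)%C =
      (y1^*)%C * (e / rc) + (y2^*)%C * (e / rc) ^+ 2 + (y3^*)%C * (e / rc) ^+ 3.
    move=> er; have e0 := circle_neq0 r0 er.
    rewrite /Y !(conjcD, conjcX, conjcM, conjcV) conj_rc !(conj_e e er); field.
    by rewrite rc0 e0.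
  (* [hX], [hY] and [hw] expand |X|^2, |Y|^2 and w X Y in powers of e on the circle, using that the
     conjugate of e is r^2/e. *)
  pose hX e := (x0 * (x0^*)%C + x1 * (x1^*)%C + x2 * (x2^*)%C) +
    ((x1 * (x0^*)%C + x2 * (x1^*)%C) / rc) * e ^+ 1 + (x2 * (x0^*)%C / rc ^+ 2) * e ^+ 2 +
    ((x0 * (x1^*)%C + x1 * (x2^*)%C) * rc) * e^-1 ^+ 1 + (x0 * (x2^*)%C * rc ^+ 2) * e^-1 ^+ 2.
  pose hY e := (y1 * (y1^*)%C + y2 * (y2^*)%C + y3 * (y3^*)%C) +
    ((y1 * (y2^*)%C + y2 * (y3^*)%C) / rc) * e ^+ 1 + (y1 * (y3^*)%C / rc ^+ 2) * e ^+ 2 +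
    ((y2 * (y1^*)%C + y3 * (y2^*)%C) * rc) * e^-1 ^+ 1 + (y3 * (y1^*)%C * rc ^+ 2) * e^-1 ^+ 2.
  pose hw e := w e * ((x1 * y1 + x2 * y2) + (x2 * y1 / rc) * e ^+ 1 +
    ((x0 * y1 + x1 * y2 + x2 * y3) * rc) * e^-1 ^+ 1 +
    ((x0 * y2 + x1 * y3) * rc ^+ 2) * e^-1 ^+ 2 + (x0 * y3 * rc ^+ 3) * e^-1 ^+ 3).
  have P c n : cbnd r (fun e => c * e ^+ n) := cbndM (cbnd_cst r c) (cbndX n (cbnd_id r)).
  have V c n : cbnd r (fun e => c * e^-1 ^+ n) := cbndM (cbnd_cst r c) (cbndX n (cbnd_inv r)).
  have bX : cbnd r hX by repeat apply: cbndD => //; exact: cbnd_cst.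
  have bY : cbnd r hY by repeat apply: cbndD => //; exact: cbnd_cst.
  have bw : cbnd r hw.
    apply: cbndM (cbnd_C1 wC r1) _; repeat apply: cbndD => //; exact: cbnd_cst.
  have b2w : cbnd r (fun e => 2 * hw e) := cbndM (cbnd_cst r 2) bw.
  have pos e : nrm e = r -> 0 <= complex.Re ((hX e + hY e) - 2 * hw e).
    move=> er; have e0 := circle_neq0 r0 er.
    have EX : hX e = X e * ((X e)^*)%C.
      by rewrite cX // /hX /X; field; rewrite e0 rc0.
    have EY : hY e = Y e * ((Y e)^*)%C.
      by rewrite cY // /hY /Y; field; rewrite e0 rc0.
    have Ew : hw e = w e * (X e * Y e).
      by rewrite /hw /X /Y; congr (_ * _); field; rewrite e0 rc0.
    rewrite ReB ReD EX EY !Re_mul_conj Ew.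
    have := le_trans (ler_norm _) (Re_le_nrm (2 * (w e * (X e * Y e)))).
    rewrite !nrmM nrm_nat.
    have we : nrm (w e) <= 1 by apply: w1; rewrite er.
    have := nrm_ge0 (w e); have := nrm_ge0 (X e); have := nrm_ge0 (Y e).
    move: (nrm (w e)) (nrm (X e)) (nrm (Y e)) we => a b c a1 c0 b0 a0 h.
    rewrite subr_ge0; apply: le_trans h _.
    have bc : a * (b * c) <= b * c by rewrite ler_piMl // mulr_ge0.
    have := sqr_ge0 (b - c); rewrite sqrrB; lra.
  have hb : cbnd r (fun e => (hX e + hY e) - 2 * hw e).
    have [U hU] := cbndD bX bY; have [U' hU'] := b2w.
    by exists (U + U') => e er; apply: le_trans (nrmB _ _) _; rewrite lerD ?hU ?hU'.
  have := mean_Re_ge0 r0' hb pos.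
  rewrite meanB //; last exact: cbndD.
  rewrite meanD // meanZ // /hX /hY /hw !mean_laurent // (mean_w_laurent _ _ _ _ _ wC) //.
  rewrite -/c1 -/c2 -/c3.
  rewrite ReB !ReD !Re_mul_conj.
  have -> : (2 : R[i]) = ((2 : R)%:C)%C by rewrite rmorph_nat.
  have -> : (x0 * y1 + x1 * y2 + x2 * y3) * rc * c1 + (x0 * y2 + x1 * y3) * rc ^+ 2 * c2 +
      x0 * y3 * rc ^+ 3 * c3 =
      rc * (c1 * (y1 * x0 + y2 * x1 + y3 * x2)) +
      ((r ^+ 2)%:C)%C * (c2 * (y2 * x0 + y3 * x1)) + ((r ^+ 3)%:C)%C * (c3 * (y3 * x0)).
    by rewrite !rmorphXn -/rc; ring.
  by rewrite ReZ !ReD !ReZ -/A -/B -/D /S; lra.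
have -> : complex.Re (y1 * (c1 * x0) + y2 * (c2 * x0 + c1 * x1) +
    y3 * (c3 * x0 + c2 * x1 + c1 * x2)) = A + B + D.
  by rewrite /A /B /D -!ReD; congr complex.Re; ring.
apply/ler_addgt0Pr => eps eps0.
(* With r = 1 - t one has 1 - r = t, 1 - r^2 <= 2 t and 1 - r^3 <= 3 t; doubled, these give the
   weights 2, 4, 6, and the final 1 keeps [M] positive. *)
set M := 2 * `|A| + 4 * `|B| + 6 * `|D| + 1.
have nA := normr_ge0 A; have nB := normr_ge0 B; have nD := normr_ge0 D.
have M0 : 0 < M by rewrite /M; lra.
pose t := Num.min (1 / 2) (eps / M).
have t0 : 0 < t by rewrite lt_min divr_gt0 //= divr_gt0.
have t2 : t <= 1 / 2 by rewrite ge_min lexx.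
have tM : t * M <= eps by rewrite -ler_pdivlMr // ge_min lexx orbT.
have /main : 0 < 1 - t < 1 by lra.
have hA := ler_norm A; have hB := ler_norm B; have hD := ler_norm D.
have E2 : (1 - t) ^+ 2 = 1 - t * (2 - t) by ring.
have E3 : (1 - t) ^+ 3 = 1 - t * (3 - 3 * t + t ^+ 2) by ring.
rewrite E2 E3.
have b1 : t * A <= t * `|A| by rewrite ler_pM2l.
have b2 : t * (2 - t) * B <= t * (2 * `|B|).
  rewrite -mulrA ler_pM2l //; nra.
have b3 : t * (3 - 3 * t + t ^+ 2) * D <= t * (3 * `|D|).
  have q1 : 0 <= 3 - 3 * t + t ^+ 2 by nra.
  have q2 : 3 - 3 * t + t ^+ 2 <= 3 by nra.
  rewrite -mulrA ler_pM2l //; apply: le_trans (ler_wpM2l q1 hD) _.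
  by rewrite ler_wpM2r.
move: tM; rewrite /M; lra.
Qed.

(** The contraction is evaluated at one vector adapted to the phase u of K = c3 D + conj(c1) c2^2,
    so that the triangle inequality loses nothing. *)
Lemma schur_ineq (c1 c2 c3 : R[i]) :
  (forall x0 x1 x2 y1 y2 y3 : R[i],
    2 * complex.Re (y1 * (c1 * x0) + y2 * (c2 * x0 + c1 * x1) +
      y3 * (c3 * x0 + c2 * x1 + c1 * x2)) <=
    nrm x0 ^+ 2 + nrm x1 ^+ 2 + nrm x2 ^+ 2 + nrm y1 ^+ 2 + nrm y2 ^+ 2 + nrm y3 ^+ 2) ->
  [/\ nrm c1 <= 1, nrm c1 ^+ 2 + nrm c2 ^+ 2 + nrm c3 ^+ 2 <= 1 &
  nrm (c3 * ((1 - nrm c1 ^+ 2)%:C)%C + (c1^*)%C * c2 ^+ 2) <=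
    (1 - nrm c1 ^+ 2) ^+ 2 - nrm c2 ^+ 2].
Proof.
move=> H; set p := nrm c1; set q := nrm c2; set D := 1 - p ^+ 2.
(* Taking y to be the conjugate of the image vector turns the bilinear bound into the contraction
   property. *)
have T x0 x1 x2 : nrm (c1 * x0) ^+ 2 + nrm (c2 * x0 + c1 * x1) ^+ 2 +
    nrm (c3 * x0 + c2 * x1 + c1 * x2) ^+ 2 <= nrm x0 ^+ 2 + nrm x1 ^+ 2 + nrm x2 ^+ 2.
  have := H x0 x1 x2 ((c1 * x0)^*)%C ((c2 * x0 + c1 * x1)^*)%C
    ((c3 * x0 + c2 * x1 + c1 * x2)^*)%C.
  rewrite !ReD !(mulrC (_^*)%C) !Re_mul_conj !nrm_conj; lra.
have p0 : 0 <= p := nrm_ge0 _; have q0 : 0 <= q := nrm_ge0 _.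
have T1 : p ^+ 2 + q ^+ 2 + nrm c3 ^+ 2 <= 1.
  by have := T 1 0 0; rewrite !mulr1 !mulr0 !addr0 nrm1 nrm0 expr0n expr1n !addr0.
have D0 : 0 <= D by rewrite /D; have := sqr_ge0 q; have := sqr_ge0 (nrm c3); lra.
split=> //.
  by rewrite -(ler_pXn2r (ltn0Sn 1)) ?nnegrE // expr1n; move: D0; rewrite /D subr_ge0.
set K := _ + _; set k := nrm K.
(* If D = 0 then |c1| = 1 forces c2 = 0 and both sides vanish; otherwise division by D is
   allowed. *)
have [DE|Dn] := eqVneq D 0.
  have z2 : nrm c2 ^+ 2 = 0.
    by apply/eqP; rewrite eq_le sqr_ge0 andbT; move: DE T1; have := sqr_ge0 (nrm c3); rewrite /D -/q; lra.
  have c20 : c2 = 0 by apply/eqP; rewrite -nrm_eq0 -sqrf_eq0 z2.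
  rewrite /k /K DE rmorph0 mulr0 add0r /q c20 nrm0 !expr0n /= mulr0 nrm0.
  by rewrite subr0.
have Dp : 0 < D by rewrite lt_neqAle eq_sym Dn.
have [u [u1 Ku]] : exists u : R[i], nrm u = 1 /\ K = u * (k%:C)%C.
  have [K0|K0] := eqVneq K 0.
    by exists 1; rewrite nrm1 /k K0 nrm0 rmorph0 mulr0.
  have k0 : k != 0 by rewrite nrm_eq0.
  exists (K / (k%:C)%C); rewrite nrmM nrmV nrmR ger0_norm ?nrm_ge0 // divff //.
  by rewrite divfK // -nrm_eq0 nrmR normr_eq0.
have k0 : 0 <= k := nrm_ge0 _.
have uu : u * (u^*)%C = 1 by rewrite mul_conj u1 expr1n rmorph1.
pose Dc := (D%:C)%C; have Dc0 : Dc != 0 by rewrite -nrm_eq0 nrmR normr_eq0.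
have cc1 : c1 * (c1^*)%C = 1 - Dc.
  by rewrite mul_conj -/p /Dc /D rmorphB rmorph1; ring.
have cc2 : c2 * (c2^*)%C = ((q ^+ 2)%:C)%C by rewrite mul_conj.
(* The test vector is (D, x1, conj(c1) A / D). The second output is u conj(x1), whose modulus
   cancels against |x1|, and the third is A / D. With p^2 = 1 - D there remains |A|^2 <= D^4, where
   |A| = k + q^2. *)
pose x1 := (c1^*)%C * c2 + (c2^*)%C * u.
pose A := c3 * Dc + c2 * x1.
have AE : A = u * ((k + q ^+ 2)%:C)%C.
  have -> : A = K + (c2 * (c2^*)%C) * u by rewrite /A /x1 /K -/Dc; ring.
  by rewrite cc2 {1}Ku rmorphD; ring.
have nA : nrm A = k + q ^+ 2.
  by rewrite AE nrmM u1 mul1r nrmR ger0_norm // addr_ge0 // sqr_ge0.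
have := T Dc x1 ((c1^*)%C * (A / Dc)).
have -> : c2 * Dc + c1 * x1 = u * (x1^*)%C.
  have -> : (x1^*)%C = c1 * (c2^*)%C + c2 * (u^*)%C.
    by rewrite /x1 conjcD !conjcM !conjcK.
  have -> : u * (c1 * (c2^*)%C + c2 * (u^*)%C) = u * c1 * (c2^*)%C + c2 * (u * (u^*)%C) by ring.
  have -> : c2 * Dc + c1 * x1 = c2 * Dc + (c1 * (c1^*)%C) * c2 + u * c1 * (c2^*)%C by rewrite /x1; ring.
  by rewrite uu cc1; ring.
have -> : c3 * Dc + c2 * x1 + c1 * ((c1^*)%C * (A / Dc)) = A / Dc.
  rewrite -/A mulrA cc1; field; exact: Dc0.
rewrite !nrmM nrmV u1 mul1r !nrm_conj -/p nrmR ger0_norm // nA.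
rewrite !exprMn exprVn -/x1 => h.
have D2 : 0 < D ^+ 2 by rewrite exprn_gt0.
have h2 : (k + q ^+ 2) ^+ 2 / D ^+ 2 * D <= D ^+ 2 * D.
  have pD : p ^+ 2 = 1 - D by rewrite /D; ring.
  by move: h; rewrite pD; clearbody D; lra.
have h3 : (k + q ^+ 2) ^+ 2 <= (D ^+ 2) ^+ 2.
  by move: h2; rewrite ler_pM2r // ler_pdivrMr // -expr2.
have : k + q ^+ 2 <= D ^+ 2.
  by rewrite -(ler_pXn2r (ltn0Sn 1)) ?nnegrE ?addr_ge0 ?sqr_ge0 // ltW.
lra.
Qed.

(** With p, q, s the moduli and D = 1 - p^2, Schur's inequality divided by 1 - p reads s (1 + p) <=
    D (1 + p) - q^2. The goal is therefore multiplied by 1 + p, which eliminates s, and then q <= D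
    leaves a polynomial in p. *)
Lemma schwarz_final (c1 c2 c3 : R[i]) : nrm c1 <= 1 ->
  nrm (c3 * ((1 - nrm c1 ^+ 2)%:C)%C + (c1^*)%C * c2 ^+ 2) <=
    (1 - nrm c1 ^+ 2) ^+ 2 - nrm c2 ^+ 2 ->
  nrm c1 ^+ 2 + nrm c2 ^+ 2 + nrm c3 ^+ 2 <= 1 ->
  nrm (- (13 / 768) * c1 ^+ 4 - 7 / 48 * c1 ^+ 2 * c2 - c2 ^+ 2 / 3 + 3 / 8 * c1 * c3) <= 1 / 3.
Proof.
move=> p1 H T1.
have HK : nrm c3 * (1 - nrm c1 ^+ 2) <=
    (1 - nrm c1 ^+ 2) ^+ 2 - nrm c2 ^+ 2 + nrm c1 * nrm c2 ^+ 2.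
  have D0 : 0 <= 1 - nrm c1 ^+ 2.
    by rewrite subr_ge0 exprn_ile1 // nrm_ge0.
  have := nrm_ler_sub (c3 * ((1 - nrm c1 ^+ 2)%:C)%C) (- ((c1^*)%C * c2 ^+ 2)).
  by rewrite opprK nrmN !nrmM nrm_conj nrmR (ger0_norm D0); lra.
apply: (@le_trans _ _ (13 / 768 * nrm c1 ^+ 4 + 7 / 48 * nrm c1 ^+ 2 * nrm c2 +
    nrm c2 ^+ 2 / 3 + 3 / 8 * nrm c1 * nrm c3)).
  have nf (m n : nat) (x : R[i]) : nrm (m%:R / n%:R * x) = m%:R / n%:R * nrm x.
    by rewrite nrmM nrmM nrmV !nrm_nat.
  have E1 : nrm (- (13 / 768) * c1 ^+ 4) = 13 / 768 * nrm c1 ^+ 4.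
    by rewrite mulNr nrmN nf nrmX.
  have E2 : nrm (7 / 48 * c1 ^+ 2 * c2) = 7 / 48 * nrm c1 ^+ 2 * nrm c2.
    by rewrite -mulrA nf nrmM nrmX mulrA.
  have E3 : nrm (c2 ^+ 2 / 3) = nrm c2 ^+ 2 / 3 by rewrite nrmM nrmX nrmV nrm_nat.
  have E4 : nrm (3 / 8 * c1 * c3) = 3 / 8 * nrm c1 * nrm c3.
    by rewrite -mulrA nf nrmM mulrA.
  rewrite -E1 -E2 -E3 -E4; apply: le_trans (nrmD _ _) _; rewrite lerD2r.
  apply: le_trans (nrmB _ _) _; rewrite lerD2r; exact: nrmB.
have HE := le_trans (nrm_ge0 _) H; rewrite subr_ge0 in HE.
have := nrm_ge0 c1; have := nrm_ge0 c2; have := nrm_ge0 c3.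
move: (nrm c1) (nrm c2) (nrm c3) p1 HK T1 HE {H} => p q s p1 HK T1 HE s0 q0 p0.
set D := 1 - p ^+ 2 in HK HE.
have qD : q <= D /\ s * (1 + p) <= D * (1 + p) - q ^+ 2.
  (* At p = 1 division by 1 - p is impossible, but there [T1] forces q = s = 0. *)
  have [pE|pn] := eqVneq p 1.
    have DE : D = 0 by rewrite /D pE; ring.
    have qE : q = 0 by apply/eqP; rewrite -sqrf_eq0 eq_le sqr_ge0 andbT; move: T1; rewrite pE; have := sqr_ge0 s; lra.
    have sE : s = 0 by apply/eqP; rewrite -sqrf_eq0 eq_le sqr_ge0 andbT; move: T1; rewrite pE; have := sqr_ge0 q; lra.
    by rewrite DE qE sE; lra.
  have p1' : 0 < 1 - p by rewrite subr_gt0 lt_neqAle pn.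
  have Dp : D = (1 - p) * (1 + p) by rewrite /D; ring.
  have sD : s * (1 + p) <= D * (1 + p) - q ^+ 2.
    rewrite -(ler_pM2l p1'); move: HK; rewrite {1}Dp.
    have -> : D ^+ 2 = (1 - p) * (D * (1 + p)) by rewrite {1}expr2 {1}Dp; ring.
    lra.
  split=> //; have D0 : 0 < D by rewrite Dp mulr_gt0 //; lra.
  by rewrite -(ler_pXn2r (ltn0Sn 1)) ?nnegrE // ltW.
move: qD => [qD sD]; have D0 := le_trans q0 qD.
have t0 := sqr_ge0 p.
have o1 : 0 < 1 + p by lra.
rewrite -(ler_pM2r o1).
have h1 : 3 / 8 * p * s * (1 + p) <= 3 / 8 * p * (D * (1 + p) - q ^+ 2).
  by rewrite -mulrA ler_wpM2l // mulr_ge0.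
have h2 : 7 / 48 * p ^+ 2 * q * (1 + p) <= 7 / 48 * p ^+ 2 * D * (1 + p).
  by rewrite ler_pM2r // ler_wpM2l // mulr_ge0.
(* After eliminating s the coefficient of q^2 is (1 + p)/3 - 3 p/8 = (8 - p)/24, which is positive,
   so q may be replaced by D. *)
have h3 : (8 - p) / 24 * q ^+ 2 <= (8 - p) / 24 * D ^+ 2.
  by rewrite ler_wpM2l //; lra.
have h4 : (13 / 768 * p ^+ 4 + 7 / 48 * p ^+ 2 * D + D * (8 + p ^+ 2) / 24) * (1 + p) <=
    1 / 3 * (1 + p).
  rewrite ler_pM2r // /D; have := sqr_ge0 (p ^+ 2); rewrite -exprM; lra.
have e5 : (8 - p) / 24 * D ^+ 2 + 3 / 8 * p * (D * (1 + p)) = D * (8 + p ^+ 2) / 24 * (1 + p).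
  by rewrite /D; field.
lra.
Qed.

End SchwarzCoefficients.

(** * The logarithmic inverse coefficients *)

Section LogInverseCoefficients.
Variable R : realType.
Implicit Types (f g w : R[i] -> R[i]) (z : R[i]).

Lemma C1_coef0 f f' : C1 f f' -> coef f 0 = f 0.
Proof. by move=> fC; have [_ -> //] := C1_analytic fC; rewrite ?nrm0 // pser0. Qed.

Lemma C1_coefS f f' n : C1 f f' -> coef f n.+1 = coef f' n / n.+1%:R.
Proof.
move=> fC; have [ra fa _] := C1_analytic fC.
have -> : coef f' n = dcoef (coef f) n.
  apply: (analytic_coef n ltr01 (radius_dcoef ra)) => z z1.
  exact: deriv_at_unique (fC.1 _ z1) (analytic_deriv ra z1 fa).
by rewrite /dcoef mulrAC mulfV ?mul1r // pnatr_eq0.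
Qed.

(** Identities between derivatives hold on the disc only, not as equalities of functions; this lets
    both sides be differentiated. *)
Lemma disc_deriv_unique f g z d e : (forall x, nrm x < 1 -> f x = g x) -> nrm z < 1 ->
  deriv_at f z d -> deriv_at g z e -> d = e.
Proof.
move=> fg z1 df; apply: deriv_at_unique.
apply: (@deriv_at_local _ f g z d (1 - nrm z)) => //; first by rewrite subr_gt0.
by move=> h hr; apply: fg; apply: le_lt_trans (nrmD _ _) _; lra.
Qed.

Lemma cont_at_disc f g z : (forall x, nrm x < 1 -> f x = g x) -> nrm z < 1 ->
  cont_at f z -> cont_at g z.
Proof.
move=> fg z1 fc eps /fc[del del0 Hd].
exists (Num.min (1 - nrm z) del) => [|h]; first by rewrite lt_min subr_gt0 z1.
rewrite lt_min => /andP[hr /Hd]; rewrite !fg //.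
by apply: le_lt_trans (nrmD _ _) _; lra.
Qed.

(** With P = G (2 - G^2), the equation G' = P w' / 2 is easily differentiated since P' = G' (2 - 3
    G^2). Two further derivatives, evaluated at 0 where G = P = 1, give the coefficients. *)
Lemma coef_relations f w w1 : C1 f (fun x => frakB (w x)) -> C1 w w1 ->
  (forall x, nrm x < 1 -> nrm (w x) < 1) -> w 0 = 0 ->
  [/\ coef f 2 = coef w 1 / 4,
      coef f 3 = coef w 2 / 6 - coef w 1 ^+ 2 / 24 &
      coef f 4 = coef w 3 / 8 - coef w 1 * coef w 2 / 16 - 5 / 192 * coef w 1 ^+ 3].
Proof.
move=> fC wC wD w0; have z0 : nrm (0 : R[i]) < 1 by rewrite nrm0.
pose G x := frakB (w x).
have [g1 gC] := C1_deriv fC; have [g2 g1C] := C1_deriv gC; have [g3 g2C] := C1_deriv g1C.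
have [w2 w1C] := C1_deriv wC; have [w3 w2C] := C1_deriv w1C.
pose P x := G x * (2 - G x * G x).
have E1 z : nrm z < 1 -> g1 z = P z * w1 z / 2.
  move=> z1; have := deriv_at_unique (gC.1 _ z1) (frakB_comp_deriv wD z1 (wC.1 _ z1)).
  by rewrite -/(G z) expr2.
have dP z : nrm z < 1 -> deriv_at P z (g1 z * (2 - 3 * (G z * G z))).
  move=> z1; have dG := gC.1 _ z1.
  have := deriv_atM dG (deriv_atB (deriv_at_cst 2 z) (deriv_atM dG dG)).
  by move/deriv_at_eq; apply; rewrite -/(G z); ring.
have E2 z : nrm z < 1 ->
    g2 z = (P z * w2 z + w1 z * (g1 z * (2 - 3 * (G z * G z)))) / 2.
  move=> z1; apply: (disc_deriv_unique E1 z1 (g1C.1 _ z1)).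
  have := deriv_atM (deriv_atM (dP _ z1) (w1C.1 _ z1)) (deriv_at_cst 2^-1 z).
  by move/deriv_at_eq; apply; ring.
have E3 : g3 0 = (P 0 * w3 0 + w2 0 * (g1 0 * (2 - 3 * (G 0 * G 0))) +
     w1 0 * (g2 0 * (2 - 3 * (G 0 * G 0)) - g1 0 * (6 * G 0 * g1 0)) +
     w2 0 * (g1 0 * (2 - 3 * (G 0 * G 0)))) / 2.
  apply: (disc_deriv_unique E2 z0 (g2C.1 _ z0)).
  have dG := gC.1 _ z0.
  have d3 := deriv_atB (deriv_at_cst 2 0) (deriv_atM (deriv_at_cst 3 0) (deriv_atM dG dG)).
  have := deriv_atM (deriv_atD (deriv_atM (dP _ z0) (w2C.1 _ z0))
    (deriv_atM (w1C.1 _ z0) (deriv_atM (g1C.1 _ z0) d3))) (deriv_at_cst 2^-1 0).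
  by move/deriv_at_eq; apply; rewrite -/(G 0); ring.
have G0 : G 0 = 1 by rewrite /G w0 frakB0.
have P0 : P 0 = 1 by rewrite /P G0; ring.
have W1 : coef w 1 = w1 0 by rewrite (C1_coefS 0 wC) (C1_coef0 w1C) divr1.
have W2 : coef w 2 = w2 0 / 2.
  by rewrite (C1_coefS 1 wC) (C1_coefS 0 w1C) (C1_coef0 w2C) divr1.
have [w4 w3C] := C1_deriv w2C; have [g4 g3C] := C1_deriv g2C.
have W3 : coef w 3 = w3 0 / 6.
  by rewrite (C1_coefS 2 wC) (C1_coefS 1 w1C) (C1_coefS 0 w2C) (C1_coef0 w3C); field.
have F2 : coef f 2 = g1 0 / 2 by rewrite (C1_coefS 1 fC) (C1_coefS 0 gC) (C1_coef0 g1C) divr1.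
have F3 : coef f 3 = g2 0 / 6.
  by rewrite (C1_coefS 2 fC) (C1_coefS 1 gC) (C1_coefS 0 g1C) (C1_coef0 g2C); field.
have F4 : coef f 4 = g3 0 / 24.
  by rewrite (C1_coefS 3 fC) (C1_coefS 2 gC) (C1_coefS 1 g1C) (C1_coefS 0 g2C) (C1_coef0 g3C); field.
rewrite F2 F3 F4 W1 W2 W3 E3 (E2 _ z0) (E1 _ z0) P0 G0.
by split; field.
Qed.

Lemma H21invE f (c1 c2 c3 : R[i]) : coef f 2 = c1 / 4 ->
  coef f 3 = c2 / 6 - c1 ^+ 2 / 24 ->
  coef f 4 = c3 / 8 - c1 * c2 / 16 - 5 / 192 * c1 ^+ 3 ->
  H21inv f = (- (13 / 768) * c1 ^+ 4 - 7 / 48 * c1 ^+ 2 * c2 - c2 ^+ 2 / 3 + 3 / 8 * c1 * c3) / 48.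
Proof.
move=> E2 E3 E4; rewrite /H21inv /Gamma1 /Gamma2 /Gamma3 E2 E3 E4; by field.
Qed.

(** Two stages: f' = B(w) is differentiable, hence continuous, so f is [C1] and f'' exists and is
    continuous. Only then does w' = 2 f'' / (B (2 - B^2)) show that w' is continuous. *)
Lemma frakB_subord_C1 f w : (forall z, nrm z < 1 -> derivable (f : R[i]^o -> R[i]^o) z 1) ->
  (forall z, nrm z < 1 -> derivable (w : R[i]^o -> R[i]^o) z 1) ->
  (forall z, nrm z < 1 -> nrm (w z) < 1) ->
  (forall z, nrm z < 1 -> dC f z = frakB (w z)) ->
  C1 f (fun x => frakB (w x)) /\ C1 w (dC w).
Proof.
move=> df dw wD fB; pose G x := frakB (w x).
have wd z : nrm z < 1 -> deriv_at w z (dC w z) by move=> /dw/derivable_deriv_at.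
have Gd z : nrm z < 1 -> deriv_at G z (G z * (2 - G z ^+ 2) * dC w z / 2).
  by move=> z1; apply: frakB_comp_deriv => //; exact: wd.
have fC : C1 f G.
  split=> z z1; last exact: deriv_at_cont (Gd _ z1).
  by rewrite /G -fB //; apply: derivable_deriv_at; exact: df.
split=> //; split=> // z z1.
have [g1 gC] := C1_deriv fC.
apply: (@cont_at_disc (fun x => g1 x * (2 * (G x * (2 - G x ^+ 2))^-1))) => //.
  move=> x x1; rewrite (deriv_at_unique (gC.1 _ x1) (Gd _ x1)); field.
  by rewrite frakB_neq0 ?twoMfrakB_neq0 ?wD.
apply: cont_atM (gC.2 _ z1) _; apply: cont_atM; first exact: deriv_at_cont (deriv_at_cst _ _).
apply: cont_atV; first by rewrite mulf_neq0 ?frakB_neq0 ?twoMfrakB_neq0 ?wD.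
have Gc := deriv_at_cont (Gd _ z1).
apply: cont_atM => //; apply: cont_atD; first exact: deriv_at_cont (deriv_at_cst _ _).
exact: deriv_at_cont (deriv_atN (deriv_at_comp (Gd _ z1) (deriv_atX 2 _))).
Qed.

Lemma H21inv_bound f : classBT f -> nrm (H21inv f) <= 1 / 144.
Proof.
move=> [[fh _ _ _] [w [wh wD w0 fB]]].
have wD' z : nrm z < 1 -> nrm (w z) < 1 by move=> z1; apply/inDE/wD/inDE.
have [|||fC wC] := @frakB_subord_C1 f w _ _ wD'.
- by move=> z z1; apply: fh; apply/inDE.
- by move=> z z1; apply: wh; apply/inDE.
- by move=> z z1; apply: fB; apply/inDE.
have [E2 E3 E4] := coef_relations fC wC wD' w0.
rewrite (H21invE E2 E3 E4) nrmM nrmV nrm_nat.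
have [|p1 T1 K] := @schur_ineq R (coef w 1) (coef w 2) (coef w 3).
  move=> *; apply: toeplitz_ineq wC w0 _ => z z1; exact/ltW/wD'.
have := schwarz_final p1 K T1; lra.
Qed.

(** * Univalence and the extremal function *)

(** The Noshiro-Warschawski criterion: with k = conj(y - x), [mvt_Re] equates Re(k (f(y) - f(x)))
    with |y - x|^2 times a positive real part. *)
Lemma pos_Re_deriv_inj f (f' : R[i] -> R[i]) :
  (forall z, nrm z < 1 -> deriv_at f z (f' z)) ->
  (forall z, nrm z < 1 -> 0 < complex.Re (f' z)) ->
  forall x y, nrm x < 1 -> nrm y < 1 -> f x = f y -> x = y.
Proof.
move=> df pf x y x1 y1 fxy; apply/eqP; rewrite eq_sym -subr_eq0; apply/negPn/negP => xy.
have [t t01] := mvt_Re ((y - x)^*)%C df x1 y1.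
rewrite fxy subrr mulr0 mulrCA (mulrC (_^*)%C) mul_conj mulrC ReZ => /esym/eqP.
rewrite mulf_eq0 sqrf_eq0 nrm_eq0 (negPf xy) /= gt_eqF //.
by apply: pf; exact: nrm_segment.
Qed.

Lemma C1_primitive g g' : C1 g g' -> exists F : R[i] -> R[i],
  F 0 = 0 /\ forall z, nrm z < 1 -> deriv_at F z (g z).
Proof.
move=> gC; have [ra ga _] := C1_analytic gC.
pose a k := if k is m.+1 then coef g m / m.+1%:R else 0.
have aE : dcoef a = coef g.
  by apply/funext => k; rewrite /dcoef /a mulrC divfK // pnatr_eq0.
have rad : radius_ge 1 a.
  move=> s /[dup] s01 /ra[B hB]; have /andP[s0 s1] := s01.
  have B0 : 0 <= B by apply: le_trans (hB 0%N); rewrite mulr_ge0 ?nrm_ge0 ?exprn_ge0.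
  exists B => -[|k]; first by rewrite nrm0 mul0r.
  apply: le_trans (hB k); rewrite nrmM nrmV nrm_nat exprSr.
  have k1 : k.+1%:R^-1 <= 1 :> R by rewrite invf_le1 // ler1n.
  have n0 := nrm_ge0 (coef g k); have sk : 0 <= s ^+ k by rewrite exprn_ge0.
  have h1 : nrm (coef g k) / k.+1%:R <= nrm (coef g k) by rewrite ler_piMr.
  have h2 : s ^+ k * s <= s ^+ k by rewrite ler_piMr // ltW.
  by apply: ler_pM; rewrite ?mulr_ge0 ?invr_ge0.
exists (pser a); split=> [|z z1]; first by rewrite pser0.
by rewrite ga // -aE; exact: pser_deriv rad z1.
Qed.

Lemma frakB_sqr_C1 : exists g', C1 (fun z : R[i] => frakB (z ^+ 2)) g'.
Proof.
pose G z : R[i] := frakB (z ^+ 2).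
have wD x : nrm (x : R[i]) < 1 -> nrm (x ^+ 2) < 1.
  by move=> x1; rewrite nrmX exprn_ilt1 // nrm_ge0.
have Gd z : nrm z < 1 -> deriv_at G z (G z * (2 - G z ^+ 2) * (2%:R * z ^+ 1) / 2).
  move=> z1; exact: (frakB_comp_deriv wD z1 (deriv_atX 2 z)).
exists (fun z => G z * (2 - G z ^+ 2) * (2%:R * z ^+ 1) / 2); split=> z z1; first exact: Gd.
have Gc := Gd _ z1; have c2 := deriv_at_cst 2 z.
apply: deriv_at_cont (deriv_atM (deriv_atM (deriv_atM Gc
  (deriv_atB c2 (deriv_at_comp Gc (deriv_atX 2 _)))) (deriv_atM (deriv_at_cst _ z) (deriv_atX 1 z)))
  (deriv_at_cst _ z)).
Qed.

(** Read off as means over a single circle, of arbitrary radius 1/2, instead of by iterated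
    derivatives. *)
Lemma coef_sqr : [/\ coef (fun z : R[i] => z ^+ 2) 1 = 0,
  coef (fun z : R[i] => z ^+ 2) 2 = 1 & coef (fun z : R[i] => z ^+ 2) 3 = 0].
Proof.
have r01 : 0 < (1 / 2 : R) < 1 by lra.
have /andP[r0 _] := r01; have r0' := ltW r0.
have [_ _ H] := C1_analytic (C1X R 2).
split; rewrite -(H _ _ r01).
- rewrite -(mean_X_eq0 r01 (ltn0Sn 0)); apply: eq_mean => // e er.
  by have := circle_neq0 r0 er => e0; field.
- rewrite -(mean_cst 1 r0'); apply: eq_mean => // e er.
  by have := circle_neq0 r0 er => e0; field.
- rewrite -(mean_V_eq0 r01 (ltn0Sn 0)); apply: eq_mean => // e er.
  by have := circle_neq0 r0 er => e0; field.
Qed.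

(** For w = z^2 one has c1 = c3 = 0 and c2 = 1, so only the term c2^2 / 3 remains, and 1/3 divided
    by 48 is 1/144. *)
Lemma H21inv_extremal f : C1 f (fun z => frakB (z ^+ 2)) -> nrm (H21inv f) = 1 / 144.
Proof.
move=> fC; have wD x : nrm (x : R[i]) < 1 -> nrm (x ^+ 2) < 1.
  by move=> x1; rewrite nrmX exprn_ilt1 // nrm_ge0.
have [E2 E3 E4] := coef_relations fC (C1X R 2) wD (expr0n _ 2).
rewrite (H21invE E2 E3 E4); have [-> -> ->] := coef_sqr.
have -> : (- (13 / 768) * 0 ^+ 4 - 7 / 48 * 0 ^+ 2 * 1 - 1 ^+ 2 / 3 + 3 / 8 * 0 * 0) / 48 =
  - (1 / 144%:R) :> R[i] by field.
by rewrite nrmN nrmM nrm1 nrmV nrm_nat.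
Qed.

End LogInverseCoefficients.

Unset Implicit Arguments.

Theorem theorem4p2 (R : realType) :
  (forall f : R[i] -> R[i], classBT f -> `|H21inv f| <= 1 / 144)
  /\
  (exists f2 : R[i] -> R[i],
     [/\ f2 0 = 0,
         (forall z, inD z -> derivable (f2 : R[i]^o -> R[i]^o) z 1 /\ dC f2 z = frakB (z ^+ 2)),
         classBT f2 &
         `|H21inv f2| = 1 / 144]).
Proof.
(* The norm of R[i] takes its values in R[i], so the bound is rewritten as an embedded real before
   comparing. *)
have E144 : 1 / 144 = ((1 / 144 : R)%:C)%C by rewrite rmorphM fmorphV rmorph1 rmorph_nat.
split=> [f fBT|].
  by rewrite E144 normC_nrm lecR; exact: H21inv_bound.
have [g' gC] := frakB_sqr_C1 R; have [f2 [f20 f2d]] := C1_primitive gC.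
have wD x : nrm (x : R[i]) < 1 -> nrm (x ^+ 2) < 1.
  by move=> x1; rewrite nrmX exprn_ilt1 // nrm_ge0.
have f2' z : inD z -> derivable (f2 : R[i]^o -> R[i]^o) z 1 /\ dC f2 z = frakB (z ^+ 2).
  by move=> /inDE z1; exact: deriv_at_derive1 (f2d _ z1).
have f2C : C1 f2 (fun z => frakB (z ^+ 2)).
  by split=> // z z1; exact: C1_cont gC _ z1.
exists f2; split=> //; last by rewrite E144 normC_nrm H21inv_extremal.
split; first split=> //.
- by move=> z /f2'[].
- move=> x y /inDE x1 /inDE y1; apply: (pos_Re_deriv_inj f2d) => // z z1.
  exact/Re_frakB_gt0/wD.
- have D0 : inD (0 : R[i]) by apply/inDE; rewrite nrm0.
  by have [_ ->] := f2' 0 D0; rewrite expr0n frakB0.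
exists (fun z => z ^+ 2); split.
- by move=> z _; have [] := deriv_at_derive1 (deriv_atX 2 z).
- by move=> z /inDE/wD/inDE.
- by rewrite expr0n.
- by move=> z /f2'[].
Qed.
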